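(* Let $P$ be a convex polytope of dimension $d\ge 1$, let $\mathcal{C}_P$ be a pointed triangulation of $P$ with apexes $\mathbf{v}_F$ ($F$ a nonempty face of $P$), and let $(h_0,\dots,h_{d+1})$ be the $h$-vector of $\mathcal{C}_P$. Then the interior polytope number sequence $(P(n)^\#)_{n\ge 0}$ of $P$ defined from these apexes satisfies, for all $n\ge 1$, $$P(n)^\#=\sum_{j=0}^{d-1} h_j\,\alpha^d(n-d-1+j).$$
   Context: A polytope is the convex hull of a finite subset of some Euclidean space; its faces include $\emptyset$ and the polytope itself, and $\mathrm{Vert}(F)$ is the vertex set of $F$. A triangulation of $P$ is a finite collection $\mathcal{C}_P$ of simplices (containing the empty simplex), closed under taking faces, in which any two members meet in a common face, and with union $P$. For a face $F$ of $P$, $\mathcal{C}_F=\{\sigma\in\mathcal{C}_P:\sigma\subseteq F\}$ denotes the induced triangulation of $F$. Pointed triangulation: a triangulation $\mathcal{C}_P$ of $P$ together with a designated vertex $\mathbf{v}_F\in \mathrm{Vert}(F)$ (the apex of $F$) for each nonempty face $F$ of $P$ such that (1) for each $k$ and each $k$-face $F$ of $P$, every $k$-simplex of $\mathcal{C}_F$ contains $\mathbf{v}_F$; (2) for any two faces $F_1,F_2$, if $\{\mathbf{v}_{F_1},\mathbf{v}_{F_2}\}\subset F_1\cap F_2$ then $\mathbf{v}_{F_1}=\mathbf{v}_{F_2}$; (3) for each $F$ and each $\mathbf{w}\in\mathrm{Vert}(F)\setminus\{\mathbf{v}_F\}$, the segment joining $\mathbf{v}_F$ and $\mathbf{w}$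 belongs to $\mathcal{C}_F$. $f$- and $h$-vectors: for a $d$-dimensional simplicial complex, $f_i$ is the number of $i$-dimensional simplices ($f_{-1}=1$), and for $0\le k\le d+1$, $h_k=\sum_{i=0}^{k}(-1)^{k-i}\binom{d+1-i}{d+1-k}f_{i-1}$. Polytope numbers: given apexes $\mathbf{v}_F$, the sequences $F(n)$ and $F(n)^\#$ (interior polytope numbers), $n\ge 0$, are defined for all nonempty faces $F$ of $P$ (including $P$) by induction on dimension and $n$. If $\dim F=0$: $F(0)=F(0)^\#=0$ and $F(n)=F(n)^\#=1$ for $n\ge1$. If $\dim F>0$: $F(0)=F(0)^\#=0$, $F(1)=1$, $F(1)^\#=0$, and for $n\ge2$, $$F(n)=F(n-1)+\sum_{G:\ \mathbf{v}_F\notin G}G(n)^\#,\qquad F(n)^\#=F(n)-\sum_{G\ne F}G(n)^\#,$$ where $G$ ranges over nonempty faces of $F$ satisfying the indicated condition. Simplex numbers: $\alpha^d(m)=\binom{m+d-1}{d}$ for $m\ge1$ and $\alpha^d(m)=0$ for $m\le 0$. *)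

(* Defs.v *)
From HB Require Export structures.
From mathcomp Require Export all_boot all_order all_algebra finmap.
From mathcomp Require Export boolp classical_sets functions cardinality fsbigop.
From mathcomp Require Export reals.

Set Implicit Arguments.
Unset Strict Implicit.
Unset Printing Implicit Defensive.

Import Order.TTheory GRing.Theory Num.Theory.

Local Open Scope classical_set_scope.
Local Open Scope ring_scope.

Section Polytopes.
Variables (R : realType) (m : nat).
Local Notation V := 'rV[R]_m.

Definition aff_hull (A : set V) : set V :=
  [set x | exists k (p : 'I_k -> V) (c : 'I_k -> R),
     [/\ forall i, A (p i), \sum_i c i = 1 & x = \sum_i c i *: p i]].

Definition conv_hull (A : set V) : set V :=
  [set x | exists k (p : 'I_k -> V) (c : 'I_k -> R),
     [/\ forall i, A (p i), forall i, 0 <= c i, \sum_i c i = 1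
       & x = \sum_i c i *: p i]].

(* The affine hull is a translate of a linear subspace of dimension k. No k is
   the dimension of the empty set: the value -1 is not represented. *)
Definition has_dim (A : set V) (k : nat) : Prop :=
  exists (x0 : V) (U : {vspace V}),
    \dim U = k /\ aff_hull A = [set x | x - x0 \in U].

Definition is_polytope (P : set V) : Prop :=
  exists2 A : set V, finite_set A & P = conv_hull A.

(* The linear form and the bound may be trivial: (0, 0) gives the face P and
   (0, 1) gives the empty face. *)
Definition is_face (P F : set V) : Prop :=
  exists (c : 'cV[R]_m) (b : R),
    (forall x, P x -> (x *m c) 0 0 <= b) /\
    F = [set x | P x /\ (x *m c) 0 0 = b].

Definition ne_face (P F : set V) : Prop := is_face P F /\ F !=set0.

Definition Vert (P : set V) : set V := [set v | is_face P [set v]].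

Definition aff_indep k (p : 'I_k -> V) : Prop :=
  forall c : 'I_k -> R,
    \sum_i c i = 0 -> \sum_i c i *: p i = 0 -> forall i, c i = 0.

(* k = 0 gives the empty simplex. *)
Definition is_simplex (S : set V) : Prop :=
  exists k (p : 'I_k -> V), aff_indep p /\ S = conv_hull (range p).

Record triangulation (P : set V) (C : set (set V)) : Prop := Triangulation {
  triang_finite : finite_set C;
  triang_simplex : forall S, C S -> is_simplex S;
  triang_empty : C set0;
  triang_face : forall S T, C S -> is_face S T -> C T;
  triang_meet : forall S T, C S -> C T ->
    is_face S (S `&` T) /\ is_face T (S `&` T);
  triang_cover : \bigcup_(S in C) S = P }.

Definition induced (C : set (set V)) (F : set V) : set (set V) :=
  [set S | C S /\ S `<=` F].

(* Only the values of apex on nonempty faces of P are meaningful. *)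
Record pointed_triangulation (P : set V) (C : set (set V))
    (apex : set V -> V) : Prop := PointedTriangulation {
  pt_triang : triangulation P C;
  pt_vert : forall F, ne_face P F -> Vert F (apex F);
  pt_full : forall k F, is_face P F -> has_dim F k ->
    forall S, induced C F S -> has_dim S k -> S (apex F);
  pt_compat : forall F1 F2, ne_face P F1 -> ne_face P F2 ->
    [set apex F1; apex F2] `<=` F1 `&` F2 -> apex F1 = apex F2;
  pt_edge : forall F w, ne_face P F -> Vert F w -> w <> apex F ->
    induced C F (conv_hull [set apex F; w]) }.

(* Shifted index: fvec C i is the number f_(i-1) of (i-1)-dimensional
   simplices, with f_(-1) = 1. *)
Definition fvec (C : set (set V)) (i : nat) : nat :=
  if i is j.+1 then #|` fset_set [set S | C S /\ has_dim S j]| else 1%N.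

(* h-vector of a d-dimensional complex C, for 0 <= k <= d + 1; the natural
   number subtractions do not truncate in this range. *)
Definition hvec (C : set (set V)) (d k : nat) : int :=
  \sum_(i < k.+1)
     (-1) ^+ (k - i) * ('C(d.+1 - i, d.+1 - k))%:Z * (fvec C i)%:Z.

(* The recursion, on the dimension and on n, that determines the polytope
   numbers num F n = F(n) and interior polytope numbers inum F n = F(n)^# of
   all nonempty faces F of P; values at other sets are unconstrained. *)
Record polytope_numbers (P : set V) (apex : set V -> V)
    (num inum : set V -> nat -> int) : Prop := PolytopeNumbers {
  pn_at0 : forall F, ne_face P F -> num F 0%N = 0 /\ inum F 0%N = 0;
  pn_point : forall F, ne_face P F -> has_dim F 0 ->
    forall n, (1 <= n)%N -> num F n = 1 /\ inum F n = 1;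
  pn_at1 : forall F k, ne_face P F -> has_dim F k -> (0 < k)%N ->
    num F 1%N = 1 /\ inum F 1%N = 0;
  pn_num : forall F k, ne_face P F -> has_dim F k -> (0 < k)%N ->
    forall n, (2 <= n)%N ->
    num F n = num F n.-1
      + \sum_(G \in [set G | ne_face F G /\ ~ G (apex F)]) inum G n;
  pn_inum : forall F k, ne_face P F -> has_dim F k -> (0 < k)%N ->
    forall n, (2 <= n)%N ->
    inum F n = num F n
      - \sum_(G \in [set G | ne_face F G /\ G <> F]) inum G n }.

End Polytopes.

Definition simplex_number (d : nat) (a : int) : int :=
  if 1 <= a then ('C(`|a|%N + d - 1, d))%:Z else 0.

(* Main.v *)
Require Import Defs.
From mathcomp Require Import zify ring lra.

(** The interior polytope numbers and the right-hand side are both sums over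
    simplices of the triangulation; they are compared in three steps.

    Encoding.  A triangulation of [P] is rewritten as an abstract simplicial
    complex [K] on the finite set of its vertices ([triangulation_complex]).
    The key property of [K] is that a point has at most one expression as a
    convex combination of the vertices of a simplex ([coords_uniq]).  A simplex
    is carried by a face [F] when it lies in [F] and in no proper face of [F];
    every nonempty simplex is carried by exactly one face.

    Recursion.  In a pointed triangulation every simplex carried by [F]
    contains the apex of [F] ([apex_carried]), so the simplices of [F] avoiding
    the apex are those carried by the faces of [F] avoiding it, and the
    simplices of [F] form a cone over them with vertex the apex.  By Pascal's
    rule the numbers counting a simplex [A] of [F] with weight
    [binom (n - 2) (#|A| - 1)] obey the recursion defining the polytope numbers,
    whence, for [n >= 2], [F(n)^#] is the sum of these weights over the simplices
    carried by [F] ([inum_inner_count]).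

    Half-open decomposition.  Let [q] be a point of [P] that lies in the affine
    hull of no simplex of dimension less than [d].  For a d-simplex [S], let
    [neg S] and [pos S] be the sets of vertices of [S] at which the barycentric
    coordinate of [q] is negative, respectively positive.  A short step from an
    inner point of a simplex [A] towards [q] enters the interior of exactly one
    d-simplex [S], and [S] is characterised by [neg S <= A <= S]; a short step
    away from [q] stays in [P] exactly when [A] is carried by [P] (by Farkas'
    lemma, [prolong_or_face]), and then ends in the unique [S] with
    [pos S <= A <= S].  So the intervals [[neg S, S]] partition the complex and
    the intervals [[pos S, S]] partition the simplices carried by [P].  The first
    partition shows that [h_j] is the number of [S] with [#|neg S| = j]
    ([hvecE]); summing the weights over the second with Vandermonde's identity
    gives [binom (#|neg S| + n - 2) d] for each [S] ([inner_countE]).  No [S] has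
    [#|neg S| >= d]: [pos S] would then be a single vertex carried by [P], which
    must be the apex of [P]; but the apex is a proper face of [P]. *)

Set Implicit Arguments.
Unset Strict Implicit.
Unset Printing Implicit Defensive.

Import Order.TTheory GRing.Theory Num.Theory.

Local Open Scope classical_set_scope.
Local Open Scope ring_scope.

(** * Linear combinations, linear forms and Farkas' lemma *)

Section LinearCombinations.
Variables (R : realFieldType) (m : nat).
Local Notation V := 'rV[R]_m.

(** The value at [v] of the linear form with coordinate vector [c]. *)
Definition dot (v : V) (c : 'cV[R]_m) : R := (v *m c) 0 0.

Lemma dotDl u v c : dot (u + v) c = dot u c + dot v c.
Proof. by rewrite /dot mulmxDl mxE. Qed.

Lemma dotZl a v c : dot (a *: v) c = a * dot v c.
Proof. by rewrite /dot -scalemxAl mxE. Qed.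

Lemma dotBl u v c : dot (u - v) c = dot u c - dot v c.
Proof. by rewrite -scaleN1r dotDl dotZl mulN1r. Qed.

Lemma dotDr v c d : dot v (c + d) = dot v c + dot v d.
Proof. by rewrite /dot mulmxDr mxE. Qed.

Lemma dotZr a v c : dot v (a *: c) = a * dot v c.
Proof. by rewrite /dot -scalemxAr mxE. Qed.

Lemma dotBr v c d : dot v (c - d) = dot v c - dot v d.
Proof. by rewrite -scaleN1r dotDr dotZr mulN1r. Qed.

Lemma dot_suml (I : finType) (F : I -> V) c :
  dot (\sum_i F i) c = \sum_i dot (F i) c.
Proof. by rewrite /dot mulmx_suml summxE. Qed.

(** Points are given by families [w] indexed by a finite type; [lin w l] is the
    combination of the whole family with coefficients [l]. *)
Definition lin (T : finType) (w : T -> V) (l : T -> R) : V :=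
  \sum_i l i *: w i.

Lemma dot_lin (T : finType) (w : T -> V) l c :
  dot (lin w l) c = \sum_i l i * dot (w i) c.
Proof. by rewrite dot_suml; apply: eq_bigr => i _; rewrite dotZl. Qed.

Lemma linD (T : finType) (w : T -> V) l l' :
  lin w (fun i => l i + l' i) = lin w l + lin w l'.
Proof. by rewrite -big_split; apply: eq_bigr => i _; rewrite scalerDl. Qed.

Lemma linZ (T : finType) (w : T -> V) a l :
  lin w (fun i => a * l i) = a *: lin w l.
Proof. by rewrite scaler_sumr; apply: eq_bigr => i _; rewrite scalerA. Qed.

Lemma linB (T : finType) (w : T -> V) l l' :
  lin w (fun i => l i - l' i) = lin w l - lin w l'.
Proof. by rewrite -sumrB; apply: eq_bigr => i _; rewrite scalerBl. Qed.

Lemma lin_sum (I T : finType) (w : T -> V) (l : I -> T -> R) (c : I -> R) :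
  lin w (fun i => \sum_j c j * l j i) = \sum_j c j *: lin w (l j).
Proof.
under [RHS]eq_bigr do rewrite scaler_sumr.
rewrite exchange_big; apply: eq_bigr => i _ /=.
by rewrite scaler_suml; apply: eq_bigr => j _; rewrite scalerA.
Qed.

Lemma lin_delta (T : finType) (w : T -> V) t :
  lin w (fun i => (i == t)%:R) = w t.
Proof.
rewrite /lin (bigD1 t) //= eqxx scale1r big1 ?addr0 // => i /negPf ->.
by rewrite scale0r.
Qed.

Lemma sum_delta (T : finType) (t : T) : \sum_i (i == t)%:R = 1 :> R.
Proof. by rewrite (bigD1 t) //= eqxx big1 ?addr0 // => i /negPf ->. Qed.

(** Farkas' lemma: a vector outside a finitely generated cone is separated from
    the cone by a hyperplane through the origin. *)
Lemma farkas (T : finType) (B : {set T}) (a : T -> V) (u : V) :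
  (exists l : T -> R, [/\ forall i, 0 <= l i, forall i, i \notin B -> l i = 0
     & u = lin a l])
  \/ exists c, (forall i, i \in B -> dot (a i) c <= 0) /\ 0 < dot u c.
Proof.
have [n] := ubnP #|B|; elim: n B a u => // n IH B a u.
have [->|/finset.set0Pn[b bB]] := eqVneq B finset.set0.
  move=> _; have [->|u0] := eqVneq u 0.
    left; exists (fun=> 0); split => //.
    by rewrite /lin big1 // => i _; rewrite scale0r.
  right; have /existsP[j uj] : [exists j, u 0 j != 0].
    apply: contra_neqT u0 => /existsPn u_0; apply/rowP => j.
    by move: (u_0 j) => /negPn/eqP ->; rewrite mxE.
  exists (u 0 j *: delta_mx j 0); split=> [i|]; first by rewrite inE.
  by rewrite dotZr /dot -colE mxE -expr2 lt_def sqrf_eq0 uj sqr_ge0.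
rewrite ltnS (cardsD1 b) bB => cB; have {}cB : (#|B :\ b| < n)%N by [].
case: (IH (B :\ b) a u cB) => [[l [l0 lB ->]]|[c [cB0 uc]]].
  left; exists l; split => // i iB; apply: lB.
  by apply: contra iB; rewrite in_setD1 => /andP[].
have [bc|bc] := leP (dot (a b) c) 0.
  right; exists c; split => // i iB.
  by have [->//|ib] := eqVneq i b; apply: cB0; rewrite in_setD1 ib.
(* Project along a b onto the hyperplane orthogonal to c. *)
pose pr (v : V) : V := v - (dot v c / dot (a b) c) *: a b.
case: (IH (B :\ b) (fun i => pr (a i)) (pr u) cB) => [[l [l0 lB ul]]|].
  left.
  pose k := dot u c / dot (a b) c - \sum_i l i * (dot (a i) c / dot (a b) c).
  exists (fun i => l i + k * (i == b)%:R); split.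
  - move=> i; rewrite addr_ge0 // mulr_ge0 // subr_ge0.
    apply: (@le_trans _ _ 0); last by rewrite divr_ge0 // ltW.
    apply: sumr_le0 => j _; have [jB|jB] := boolP (j \in B :\ b).
      by rewrite mulr_ge0_le0 // mulr_le0_ge0 ?cB0 // invr_ge0 ltW.
    by rewrite lB // mul0r.
  - move=> i iB; rewrite lB ?add0r; last first.
      by apply: contra iB; rewrite in_setD1 => /andP[].
    by case: eqP iB => [->|_ _]; rewrite ?bB // mulr0.
  - rewrite linD linZ lin_delta /k scalerBl.
    move: ul; rewrite /pr /lin.
    under eq_bigr do rewrite scalerBr scalerA.
    rewrite sumrB -scaler_suml => uE; rewrite [LHS](canRL (subrK _) uE).
    by rewrite -addrA [- _ + _]addrC.
move=> [d [dB ud]]; right.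
pose d' := d - (dot (a b) d / dot (a b) c) *: c.
have dE v : dot v d' = dot (pr v) d.
  rewrite dotBr dotZr dotBl dotZl; congr (_ - _).
  by rewrite mulrC mulrCA mulrC.
exists d'; split=> [i iB|]; rewrite dE //.
have [->|ib] := eqVneq i b; last by apply: dB; rewrite in_setD1 ib.
by rewrite /pr divff ?gt_eqF // scale1r subrr /dot mul0mx mxE.
Qed.

End LinearCombinations.

(** * Affine and convex hulls of finite families *)

Section Hulls.
Variables (R : realType) (m : nat).
Local Notation V := 'rV[R]_m.

(** [l] is a system of affine weights concentrated on [A]. *)
Definition wts (T : finType) (A : {set T}) (l : T -> R) :=
  (forall i, i \notin A -> l i = 0) /\ \sum_i l i = 1.

Definition nneg (T : finType) (l : T -> R) := forall i, 0 <= l i.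

(** The affine and convex hulls of the points [w i], [i] in [A]. *)
Definition aff (T : finType) (w : T -> V) (A : {set T}) : set V :=
  [set x | exists2 l, wts A l & x = lin w l].

Definition conv (T : finType) (w : T -> V) (A : {set T}) : set V :=
  [set x | exists l, [/\ wts A l, nneg l & x = lin w l]].

(** The points [w i], [i] in [A], are affinely independent (in particular
    pairwise distinct). *)
Definition indep (T : finType) (w : T -> V) (A : {set T}) : Prop :=
  forall c, (forall i, i \notin A -> c i = 0) ->
    \sum_i c i = 0 -> lin w c = 0 -> forall i, c i = 0.

Section Family.
Variables (T : finType) (w : T -> V).
Implicit Types (A B : {set T}) (l : T -> R).

Lemma wts_sub A B l : A \subset B -> wts A l -> wts B l.
Proof.
move=> AB [lA l1]; split => // i iB; apply: lA.
by apply: contra iB; apply: (fintype.subsetP AB).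
Qed.

Lemma wts_delta A t : t \in A -> wts A (fun i => (i == t)%:R).
Proof.
move=> tA; split; last exact: sum_delta.
by move=> i; case: eqP => // ->; rewrite tA.
Qed.

Lemma wts_line A l l' t : wts A l -> wts A l' ->
  wts A (fun i => l i + t * (l' i - l i)).
Proof.
move=> [lA l1] [lA' l1']; split=> [i iA|].
  by rewrite lA // lA' // subrr mulr0 addr0.
by rewrite big_split /= -mulr_sumr sumrB l1 l1' subrr mulr0 addr0.
Qed.

Lemma lin_line l l' t :
  lin w (fun i => l i + t * (l' i - l i)) =
  lin w l + t *: (lin w l' - lin w l).
Proof. by rewrite linD linZ linB. Qed.

Lemma wts_neq0 A l : wts A l -> exists2 i, i \in A & l i != 0.
Proof.
move=> [lA l1]; apply: contrapT => l0.
move: l1; rewrite big1 => [/eqP|i _]; first by rewrite eq_sym oner_eq0.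
have [iA|/lA //] := boolP (i \in A).
by apply/eqP; apply: contrapT => /negP li; apply: l0; exists i.
Qed.

Lemma conv_aff A : conv w A `<=` aff w A.
Proof. by move=> x [l [? _ ->]]; exists l. Qed.

Lemma conv_sub A B : A \subset B -> conv w A `<=` conv w B.
Proof. by move=> AB x [l [lA l0 ->]]; exists l; split => //; apply: wts_sub lA. Qed.

Lemma conv_vertex A i : i \in A -> conv w A (w i).
Proof.
move=> iA; exists (fun j => (j == i)%:R); split; rewrite ?lin_delta //.
exact: wts_delta.
Qed.

Lemma conv_neq0 A x : conv w A x -> exists i, i \in A.
Proof.
by move=> [l [/wts_neq0[i iA _] _ _]]; exists i.
Qed.

Lemma aff_line A x y t : aff w A x -> aff w A y -> aff w A (x + t *: (y - x)).
Proof.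
move=> [l lA ->] [l' lA' ->]; exists (fun i => l i + t * (l' i - l i)).
  exact: wts_line.
by rewrite lin_line.
Qed.

Lemma conv_seg A x y t : 0 <= t <= 1 -> conv w A x -> conv w A y ->
  conv w A (x + t *: (y - x)).
Proof.
move=> /andP[t0 t1] [l [lA l0 ->]] [l' [lA' l0' ->]].
exists (fun i => l i + t * (l' i - l i)); split; rewrite ?lin_line //.
  exact: wts_line.
move=> i; rewrite mulrBr addrCA -[X in _ + (X - _)]mul1r -mulrBl.
by rewrite addr_ge0 // mulr_ge0 // subr_ge0.
Qed.

Lemma conv1 t : conv w (finset.set1 t) = [set w t].
Proof.
apply/seteqP; split => x; last by move=> ->; apply: conv_vertex; rewrite inE.
move=> [l [[lA l1] _ ->]] /=; rewrite -(lin_delta w t).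
apply: eq_bigr => i _; congr (_ *: _); have [->|it] := eqVneq i t.
  move: l1; rewrite (bigD1 t) //= big1 ?addr0 // => j jt.
  by apply: lA; rewrite inE.
by apply: lA; rewrite inE.
Qed.

Lemma sum_wts A l (F : T -> R) : wts A l ->
  \sum_i l i * F i = \sum_(i in A) l i * F i.
Proof.
move=> [lA _]; rewrite (bigID (mem A)) /= [X in _ + X]big1 ?addr0 // => i iA.
by rewrite lA // mul0r.
Qed.

Lemma indep_inj A l l' : indep w A -> wts A l -> wts A l' ->
  lin w l = lin w l' -> l =1 l'.
Proof.
move=> iA [lA l1] [lA' l1'] ll' i; apply/eqP; rewrite -subr_eq0; apply/eqP.
apply: (iA (fun i => l i - l' i)) => [j jA||].
- by rewrite lA // lA' // subr0.
- by rewrite sumrB l1 l1' subrr.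
- by rewrite linB ll' subrr.
Qed.

Lemma indep_sub A B : B \subset A -> indep w A -> indep w B.
Proof.
move=> BA iA c cB; apply: iA => i iB; apply: cB.
by apply: contra iB; apply: (fintype.subsetP BA).
Qed.

(** On affinely independent points the values of an affine function can be
    prescribed: the matrix with rows [(w i, 1)] has independent rows, hence a
    right inverse. *)
Lemma indep_interpolation A (g : T -> R) : indep w A ->
  exists (c : 'cV[R]_m) (b : R), forall i, i \in A -> dot (w i) c - b = g i.
Proof.
move=> iA.
pose W := \matrix_(i < #|A|) w (enum_val i).
pose Q : 'M[R]_(#|A|, m + 1) := row_mx W (const_mx 1).
have freeQ : row_free Q.
  apply: inj_row_free => v; rewrite mul_mx_row -row_mx0 => /eq_row_mx[v0 v1].
  apply/rowP => j; rewrite [RHS]mxE.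
  pose c i := \sum_(j < #|A| | enum_val j == i) v 0 j.
  have -> : v 0 j = c (enum_val j).
    by rewrite /c (big_pred1 j) // => k /=; rewrite (inj_eq enum_val_inj).
  apply: iA => [i iA||].
  - rewrite /c big1 // => k /eqP ki.
    by move: iA; rewrite -ki enum_valP.
  - transitivity (\sum_j v 0 j).
      by rewrite (partition_big (fun j : 'I_#|A| => enum_val j) predT).
    move/matrixP/(_ 0 0): v1; rewrite !mxE => v1; rewrite -[RHS]v1.
    by apply: eq_bigr => k _; rewrite mxE mulr1.
  - rewrite -[RHS]v0 mulmx_sum_row.
    rewrite (partition_big (fun j : 'I_#|A| => enum_val j) predT) //=.
    apply: eq_bigr => i _; rewrite scaler_suml.
    by apply: eq_bigr => k /eqP <-; rewrite rowK.
pose h := pinvmx Q *m (\col_i g (enum_val i)).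
have hE : Q *m h = \col_i g (enum_val i) by rewrite mulmxA mulmxVp // mul1mx.
exists (usubmx h), (- dsubmx h 0 0) => i iA'.
move: hE; rewrite -[h in Q *m h]vsubmxK mul_row_col.
move=> /matrixP/(_ (enum_rank_in iA' i) 0); rewrite [LHS]mxE [RHS]mxE.
rewrite enum_rankK_in // => <-; rewrite opprK; congr (_ + _).
  rewrite /dot [LHS]mxE [RHS]mxE; apply: eq_bigr => k _.
  by rewrite !mxE enum_rankK_in.
by rewrite [RHS]mxE big_ord1 [X in _ = X * _]mxE mul1r.
Qed.

End Family.
End Hulls.

(** * Dimension *)

Section Dimension.
Variables (R : realType) (m : nat).
Local Notation V := 'rV[R]_m.

Section Family.
Variables (T : finType) (w : T -> V).
Implicit Types (A B : {set T}) (l : T -> R).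

Lemma lin_enum (A : {set T}) l : (forall i, i \notin A -> l i = 0) ->
  lin w l = \sum_(j < #|A|) l (enum_val j) *: w (enum_val j).
Proof.
move=> lA; rewrite -(big_enum_val (fun i => l i *: w i)) /=.
rewrite /lin (bigID (mem A)) /= [X in _ + X]big1 ?addr0 // => i iA.
by rewrite lA // scale0r.
Qed.

Lemma wts_enum (A : {set T}) l : wts A l -> \sum_(j < #|A|) l (enum_val j) = 1.
Proof.
move=> [lA <-]; rewrite -(big_enum_val l) /=.
by rewrite [RHS](bigID (mem A)) /= [X in _ + X]big1 ?addr0.
Qed.

Lemma wts_comp (I : finType) (B : {set I}) (A : {set T}) (c : I -> R)
    (l : I -> T -> R) :
  wts B c -> (forall j, j \in B -> wts A (l j)) ->
  wts A (fun i => \sum_j c j * l j i).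
Proof.
move=> [cB c1] lA; split=> [i iA|].
  rewrite big1 // => j _; have [/lA[-> //]|/cB ->] := boolP (j \in B).
    by rewrite mulr0.
  by rewrite mul0r.
rewrite exchange_big /= -[RHS]c1; apply: eq_bigr => j _.
rewrite -mulr_sumr; have [/lA[_ ->]|/cB ->] := boolP (j \in B).
  by rewrite mulr1.
by rewrite mul0r.
Qed.

Lemma aff_lin (I : finType) (B : {set I}) (A : {set T}) (c : I -> R)
    (p : I -> V) :
  wts B c -> (forall j, j \in B -> aff w A (p j)) -> aff w A (lin p c).
Proof.
move=> cB pA; have /choice[l lP] j : exists l, j \in B -> wts A l /\ p j = lin w l.
  have [/pA[l lA ->]|_] := boolP (j \in B); first by exists l.
  by exists (fun=> 0).
exists (fun i => \sum_j c j * l j i).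
  by apply: wts_comp cB _ => j /lP[].
rewrite lin_sum; apply: eq_bigr => j _.
by have [/lP[_ ->]|/(proj1 cB) ->] := boolP (j \in B); rewrite ?scale0r.
Qed.

Lemma conv_lin (I : finType) (B : {set I}) (A : {set T}) (c : I -> R)
    (p : I -> V) :
  wts B c -> nneg c -> (forall j, j \in B -> conv w A (p j)) ->
  conv w A (lin p c).
Proof.
move=> cB c0 pA; have /choice[l lP] j :
    exists l, j \in B -> [/\ wts A l, nneg l & p j = lin w l].
  have [/pA[l lA]|_] := boolP (j \in B); first by exists l.
  by exists (fun=> 0).
exists (fun i => \sum_j c j * l j i); split.
- by apply: wts_comp cB _ => j /lP[].
- move=> i; apply: sumr_ge0 => j _.
  have [/lP[_ l0 _]|/(proj1 cB) ->] := boolP (j \in B); last by rewrite mul0r.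
  by rewrite mulr_ge0.
rewrite lin_sum; apply: eq_bigr => j _.
by have [/lP[_ _ ->]|/(proj1 cB) ->] := boolP (j \in B); rewrite ?scale0r.
Qed.

Lemma aff_hull_conv A : aff_hull (conv w A) = aff w A.
Proof.
apply/seteqP; split=> x.
  move=> [k [p [c [pA c1 ->]]]].
  apply: (@aff_lin _ [set: 'I_k]%SET) => [|j _]; last exact: conv_aff.
  by split => // i; rewrite inE.
move=> [l lA ->]; exists #|A|, (fun j => w (enum_val j)), (l \o enum_val).
split; [|exact: wts_enum|by rewrite (lin_enum (proj1 lA))].
by move=> j; apply: conv_vertex; exact: enum_valP.
Qed.

Lemma conv_hullE A (X : set V) :
  (forall x, X x <-> exists2 i, i \in A & x = w i) -> conv_hull X = conv w A.
Proof.
move=> XA; apply/seteqP; split=> x.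
  move=> [k [p [c [pX c0 c1 ->]]]].
  apply: (@conv_lin _ [set: 'I_k]%SET) => // [|j _].
    by split => // i; rewrite inE.
  by have /XA[i iA ->] := pX j; exact: conv_vertex.
move=> [l [lA l0 ->]]; exists #|A|, (fun j => w (enum_val j)), (l \o enum_val).
split; [|by move=> i; apply: l0|exact: wts_enum|by rewrite (lin_enum (proj1 lA))].
by move=> j; apply/XA; exists (enum_val j); first exact: enum_valP.
Qed.

(** The affine hull of the [w i] is the translate by [w i0] of the span of the
    differences [w i - w i0]. *)
Lemma aff_direction A i0 : i0 \in A -> exists U : {vspace V},
  aff w A = [set x | x - w i0 \in U] /\ (indep w A -> \dim U = #|A|.-1).
Proof.
move=> iA; set D := (A :\ i0)%SET.
pose X := [tuple w (enum_val j) - w i0 | j < #|D|].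
have XE (j : 'I_#|D|) : X`_j = w (enum_val j) - w i0.
  by rewrite -tnth_nth tnth_mktuple.
have DP (j : 'I_#|D|) : enum_val j != i0 /\ enum_val j \in A.
  by apply/andP; rewrite -in_setD1 enum_valP.
(* The coefficients on the [w i] of a combination, with coefficients [k], of
   the differences. *)
pose co (k : 'I_#|D| -> R) i :=
  \sum_j k j * ((i == enum_val j)%:R - (i == i0)%:R).
have coA k i : i \notin A -> co k i = 0.
  move=> iNA; rewrite /co big1 // => j _.
  have /negPf -> : i != enum_val j by apply: contraNneq iNA => ->; case: (DP j).
  have /negPf -> : i != i0 by apply: contraNneq iNA => ->.
  by rewrite subrr mulr0.
have co0 k : \sum_i co k i = 0.
  rewrite exchange_big big1 // => j _ /=.
  by rewrite -mulr_sumr sumrB !sum_delta subrr mulr0.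
have colin k : lin w (co k) = \sum_j k j *: X`_j.
  rewrite lin_sum; apply: eq_bigr => j _.
  by rewrite linB !lin_delta XE.
exists <<X>>%VS; split.
  apply/seteqP; split => x /=.
    move=> [l [lA l1] ->].
    have -> : lin w l - w i0 = \sum_i l i *: (w i - w i0).
      under eq_bigr do rewrite scalerBr.
      by rewrite sumrB -scaler_suml l1 scale1r.
    apply: memv_suml => i _; have [iA'|/lA ->] := boolP (i \in A); last first.
      by rewrite scale0r mem0v.
    have [->|ii0] := eqVneq i i0; first by rewrite subrr scaler0 mem0v.
    have iD : i \in D by rewrite in_setD1 ii0.
    apply/memvZ/memv_span/mapP; exists (enum_rank_in iD i).
      by rewrite mem_enum.
    by rewrite enum_rankK_in.
  move=> /(coord_span (X := X)) xE.
  exists (fun i => (i == i0)%:R + co (coord X ^~ (x - w i0)) i).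
    split=> [i iNA|]; last by rewrite big_split /= sum_delta co0 addr0.
    rewrite coA // addr0; case: eqP => // ii0.
    by rewrite ii0 iA in iNA.
  by rewrite linD lin_delta colin -xE addrC subrK.
move=> iw; have /eqP -> : free X.
  apply/freeP => k k0 j; have := iw (co k) (coA k) (co0 k).
  rewrite colin => /(_ k0 (enum_val j)).
  rewrite /co (bigD1 j) //= big1 ?addr0.
    by rewrite eqxx (negPf (proj1 (DP j))) subr0 mulr1.
  move=> j' jj'; rewrite (negPf (proj1 (DP j))) subr0.
  by rewrite (inj_eq enum_val_inj) eq_sym (negPf jj') mulr0.
by rewrite size_tuple (cardsD1 i0 A) iA.
Qed.

Lemma has_dim_simplex A : indep w A -> A != finset.set0 ->
  has_dim (conv w A) #|A|.-1.
Proof.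
move=> iw /finset.set0Pn[i0 iA]; have [U [affU dimU]] := aff_direction iA.
by exists (w i0), U; rewrite aff_hull_conv dimU.
Qed.

Lemma has_dim_ex A : conv w A !=set0 -> exists k, has_dim (conv w A) k.
Proof.
move=> [x /conv_neq0[i0 iA]]; have [U [affU _]] := aff_direction iA.
by exists (\dim U), (w i0), U; rewrite aff_hull_conv.
Qed.

End Family.

Lemma aff_hull_sub (S S' : set V) : S `<=` S' -> aff_hull S `<=` aff_hull S'.
Proof.
move=> SS x [k [p [c [pS c1 ->]]]]; exists k, p, c; split => // i.
exact: SS.
Qed.

Lemma sub_aff_hull (S : set V) : S `<=` aff_hull S.
Proof.
move=> x Sx; exists 1%N, (fun=> x), (fun=> 1); split => //.
  by rewrite big_ord1.
by rewrite big_ord1 scale1r.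
Qed.

Lemma has_dim_neq0 (S : set V) k : has_dim S k -> S !=set0.
Proof.
move=> [x0 [U [_ affS]]].
have : aff_hull S x0 by rewrite affS /= subrr mem0v.
move=> [[|n] [p [c [pS c1 _]]]]; last by exists (p ord0).
by move: c1; rewrite big_ord0 => /eqP; rewrite eq_sym oner_eq0.
Qed.

Lemma direction_sub (x0 x1 : V) (U0 U1 : {vspace V}) :
  [set x | x - x0 \in U0] `<=` [set x | x - x1 \in U1] -> (U0 <= U1)%VS.
Proof.
move=> sub; apply/subvP => u uU.
have /= h0 := sub x0; rewrite /= subrr mem0v in h0.
have := sub (u + x0); rewrite /= addrK => /(_ uU) h1.
have := memvB h1 (h0 isT).
by rewrite opprB addrA subrK addrK.
Qed.

Lemma has_dim_mono (S S' : set V) j k :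
  aff_hull S `<=` aff_hull S' -> has_dim S j -> has_dim S' k -> (j <= k)%N.
Proof.
move=> SS [x0 [U0 [<- a0]]] [x1 [U1 [<- a1]]].
by apply/dimvS/(@direction_sub x0 x1); rewrite -a0 -a1.
Qed.

Lemma has_dim_uniq (S : set V) j k : has_dim S j -> has_dim S k -> j = k.
Proof.
move=> Sj Sk; apply/eqP; rewrite eqn_leq.
by apply/andP; split; apply: (@has_dim_mono S S).
Qed.

Lemma has_dim_aff_hull (S S' : set V) k :
  S `<=` S' -> has_dim S k -> has_dim S' k -> aff_hull S = aff_hull S'.
Proof.
move=> SS [x0 [U0 [d0 a0]]] [x1 [U1 [d1 a1]]].
have aSS := aff_hull_sub SS.
have /eqP UU : U0 == U1.
  rewrite eqEdim d0 d1 leqnn andbT.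
  by apply: (@direction_sub x0 x1); rewrite -a0 -a1.
apply/seteqP; split=> // x; rewrite a1 a0 /= -UU => xU.
have : aff_hull S' x0 by apply: aSS; rewrite a0 /= subrr mem0v.
rewrite a1 /= -UU => /(memvB xU).
by rewrite opprB addrA subrK.
Qed.

End Dimension.

(** * Faces of polytopes and generic points *)

Section Faces.
Variables (R : realType) (m : nat).
Local Notation V := 'rV[R]_m.

Lemma face_subset (P F : set V) : is_face P F -> F `<=` P.
Proof. by move=> [c [b [_ ->]]] x []. Qed.

Lemma face_refl (P : set V) : is_face P P.
Proof.
exists 0, 0; split=> [x _|]; first by rewrite mulmx0 mxE.
by apply/seteqP; split=> x; [split=> //; rewrite mulmx0 mxE|case].
Qed.


Lemma face_restrict (P F G : set V) : is_face P G -> F `<=` P ->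
  is_face F (F `&` G).
Proof.
move=> [c [b [cP ->]]] FP; exists c, b; split=> [x /FP/cP //|].
by apply/seteqP; split=> x /= [Fx]; [case|split; [|split=> //; apply: FP]].
Qed.

Section Family.
Variables (T : finType) (w : T -> V).
Implicit Types (A B : {set T}) (l : T -> R).

(** A convex combination lies in a face only if all the points it really uses
    do. *)
Lemma face_supp B l (P F : set V) : is_face P F -> wts B l -> nneg l ->
  (forall i, i \in B -> P (w i)) -> F (lin w l) ->
  forall i, l i != 0 -> F (w i).
Proof.
move=> [c [b [cP ->]]] [lB l1] l0 PB [_]; rewrite -/(dot _ _) dot_lin => lb.
have BP i : l i != 0 -> P (w i).
  by move=> li; apply: PB; apply: contraNT li => /lB ->.
have S0 : \sum_i l i * (b - dot (w i) c) = 0.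
  under eq_bigr do rewrite mulrBr.
  by rewrite sumrB lb -mulr_suml l1 mul1r subrr.
move=> i li; split; first exact: BP.
have term0 j : true -> 0 <= l j * (b - dot (w j) c).
  move=> _; have [->|lj] := eqVneq (l j) 0; first by rewrite mul0r.
  by rewrite mulr_ge0 // subr_ge0; apply/cP/BP.
have /eqP := psumr_eq0P term0 S0 (erefl : true) (i := i).
by rewrite mulf_eq0 (negPf li) subr_eq0 => /eqP.
Qed.

Lemma conv_dot_le A c b : (forall i, i \in A -> dot (w i) c <= b) ->
  forall x, conv w A x -> dot x c <= b.
Proof.
move=> cA x [l [lA l0 ->]]; rewrite dot_lin (sum_wts _ lA).
have -> : b = \sum_(i in A) l i * b.
  by rewrite -(sum_wts (fun=> b) lA) -mulr_suml (proj2 lA) mul1r.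
by apply: ler_sum => i iA; rewrite ler_wpM2l ?cA.
Qed.

Lemma face_conv A (F : set V) : is_face (conv w A) F ->
  F = conv w [set i in A | `[< F (w i) >]]%SET.
Proof.
move=> fF; apply/seteqP; split=> x.
  move=> Fx; have [l [lA l0 xl]] := face_subset fF Fx.
  exists l; split=> //; split; last exact: (proj2 lA).
  move=> i iS; apply/eqP; apply: contraNT iS => li.
  have iA : i \in A by apply: contraNT li => /(proj1 lA) ->.
  rewrite !inE iA; apply/asboolP.
  apply: (face_supp fF lA l0) => // [j|]; first exact: conv_vertex.
  by rewrite -xl.
have [c [b [cP FE]]] := fF; move=> xF.
have /conv_sub/(_ _ xF) xA :
    [set i in A | `[< F (w i) >]]%SET \subset A.
  by apply/fintype.subsetP => i; rewrite !inE => /andP[].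
rewrite FE; split=> //; apply/eqP; rewrite eq_le; apply/andP; split.
  exact: cP.
have : dot x (-1 *: c) <= - b; last by rewrite dotZr mulN1r lerN2.
apply: conv_dot_le xF => i; rewrite !inE => /andP[_ /asboolP].
by rewrite FE => -[_ <-]; rewrite dotZr mulN1r.
Qed.

Lemma face_dot A c b : (forall i, i \in A -> dot (w i) c <= b) ->
  is_face (conv w A) (conv w [set i in A | dot (w i) c == b]%SET).
Proof.
move=> cA; pose F := [set x | conv w A x /\ dot x c = b].
have fF : is_face (conv w A) F.
  by exists c, b; split=> // x; apply: conv_dot_le.
suff -> : [set i in A | dot (w i) c == b]%SET =
    [set i in A | `[< F (w i) >]]%SET by rewrite -(face_conv fF).
apply/setP => i; rewrite !inE; have [iA|//] := boolP (i \in A).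
by apply/eqP/asboolP => [ib|[]] //; split=> //; apply: conv_vertex.
Qed.

Lemma simplex_face A B : indep w A -> B \subset A ->
  is_face (conv w A) (conv w B).
Proof.
move=> iA BA.
have [c [b cb]] := indep_interpolation (fun i => (i \in B)%:R - 1) iA.
have -> : B = [set i in A | dot (w i) c == b]%SET.
  apply/setP => i; rewrite !inE; have [iA'|iA'] := boolP (i \in A); last first.
    by apply: contraNF iA'; apply: (fintype.subsetP BA).
  rewrite -subr_eq0 cb //; case: (i \in B); rewrite ?subrr ?eqxx //.
  by rewrite sub0r oppr_eq0 oner_eq0.
apply: face_dot => i iA'; rewrite -subr_le0 cb //.
by case: (i \in B); rewrite ?subrr // sub0r lerN10.
Qed.

(** A face of a face of a polytope is a face of the polytope. *)
Lemma face_trans A (F G : set V) : is_face (conv w A) F -> is_face F G ->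
  is_face (conv w A) G.
Proof.
move=> fF fG; have FE := face_conv fF; move: (fG); rewrite FE => /face_conv ->.
have [c1 [b1 [c1P F1]]] := fF; have [c2 [b2 [c2F G2]]] := fG.
have wA i : i \in A -> conv w A (w i) by exact: conv_vertex.
have FP i : i \in A -> (dot (w i) c1 == b1) = `[< F (w i) >].
  move=> iA; rewrite F1; apply/eqP/asboolP => [|[]] //; split=> //; exact: wA.
pose N i := i \in [set i in A | ~~ `[< F (w i) >]]%SET.
pose t i := (`|dot (w i) c2 - b2| + 1) / (b1 - dot (w i) c1).
have gap i : N i -> 0 < b1 - dot (w i) c1.
  rewrite /N inE => /andP[iA nF]; rewrite subr_gt0 lt_neqAle FP // nF /=.
  exact/c1P/wA.
have t0 i : N i -> 0 <= t i.
  by move=> Ni; rewrite divr_ge0 ?(ltW (gap _ Ni)) // addr_ge0.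
(* The form [M *: c1 + c2] cuts out G once the multiple [M] of the form [c1]
   cutting out F dominates [c2] at the vertices outside F. *)
pose M := \sum_(i | N i) t i.
have MN i : N i -> dot (w i) (M *: c1 + c2) < M * b1 + b2.
  move=> Ni; have tM : t i <= M.
    by rewrite /M (bigD1 i) //= lerDl sumr_ge0 // => j /andP[/t0].
  have : `|dot (w i) c2 - b2| + 1 <= M * (b1 - dot (w i) c1).
    by rewrite -ler_pdivrMr ?gap.
  have := ler_norm (dot (w i) c2 - b2).
  rewrite dotDr dotZr; lra.
have MF i : i \in A -> F (w i) ->
    dot (w i) (M *: c1 + c2) - (M * b1 + b2) = dot (w i) c2 - b2.
  move=> iA; have := FP i iA; case: asboolP => // _ /eqP ib _.
  by rewrite dotDr dotZr ib; ring.
have -> : [set i in [set i in A | `[< F (w i) >]] | `[< G (w i) >]]%SET =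
    [set i in A | dot (w i) (M *: c1 + c2) == M * b1 + b2]%SET.
  apply/setP => i; rewrite !inE; have [iA|//] := boolP (i \in A).
  have [Fi|nF] /= := boolP `[< F (w i) >].
    move/asboolP in Fi; rewrite -[RHS]subr_eq0 MF // subr_eq0.
    by rewrite G2; apply/asboolP/eqP => [[]|].
  by rewrite lt_eqF // MN // /N inE iA.
apply: face_dot => i iA; have [Fi|nF] := boolP `[< F (w i) >].
  move/asboolP in Fi; rewrite -subr_le0 MF // subr_le0; exact: c2F.
by rewrite ltW // MN // /N inE iA.
Qed.

(** Either the segment from [q] to [x] can be prolonged beyond [x] inside the
    polytope, or some face contains [x] and not [q]: this is Farkas' lemma for
    the cone spanned by the vectors from [x] to the vertices. *)
Lemma prolong_or_face A x q : conv w A x -> conv w A q ->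
  (exists2 e : R, 0 < e & conv w A (x - e *: (q - x))) \/
  exists G, [/\ is_face (conv w A) G, G x & ~ G q].
Proof.
move=> Ax Aq; have [[l [l0 lA xq]]|[c [cA xq]]] :=
  farkas A (fun i => w i - x) (x - q).
  left; pose s := \sum_i l i.
  have xqE : x - q = lin w l - s *: x.
    rewrite xq /lin; under eq_bigr do rewrite scalerBr.
    by rewrite sumrB -scaler_suml.
  have [s0|s0] := eqVneq s 0.
    exists 1 => //; rewrite scale1r opprB.
    suff -> : x - q = 0 by rewrite addr0.
    rewrite xqE s0 scale0r subr0 /lin big1 // => i _.
    by rewrite (psumr_eq0P _ s0) // scale0r.
  have sp : 0 < s by rewrite lt_def s0 sumr_ge0.
  exists s^-1; first by rewrite invr_gt0.
  exists (fun i => s^-1 * l i); split.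
  - split=> [i /lA ->|]; first by rewrite mulr0.
    by rewrite -mulr_sumr mulVf.
  - by move=> i; rewrite mulr_ge0 // invr_ge0 ltW.
  rewrite linZ -scalerN opprB xqE scalerBr scalerA mulVf // scale1r.
  by rewrite addrC subrK.
right; exists [set y | conv w A y /\ dot y c = dot x c]; split=> //.
  exists c, (dot x c); split=> // y; apply: conv_dot_le => i /cA.
  by rewrite dotBl subr_le0.
move=> [_ qx]; by move: xq; rewrite dotBl qx subrr ltxx.
Qed.

End Family.

(** If every [n] satisfies one of finitely many properties, one of them holds
    for arbitrarily large [n]. *)
Lemma pigeonhole (I : finType) (Q : I -> nat -> Prop) :
  (forall n, exists i, Q i n) ->
  exists i, forall N, exists2 n, (N <= n)%N & Q i n.
Proof.
move=> Qn; apply: contrapT => /forallNP nQ.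
have /choice[N NP] i : exists N, forall n, (N <= n)%N -> ~ Q i n.
  have /existsNP[N NP] := nQ i; exists N => n Nn Qin.
  by apply: NP; exists n.
have [i Qi] := Qn (\max_i N i)%N.
by apply: NP Qi; rewrite leq_bigmax.
Qed.

(** [B] contains the line through any two of its points, i.e. [B] is an affine
    subspace or empty. *)
Definition line_closed (B : set V) :=
  forall x y t, B x -> B y -> B (x + t *: (y - x)).

Lemma line_closedP (B : set V) x u (t1 t2 t : R) : line_closed B -> t1 != t2 ->
  B (x + t1 *: u) -> B (x + t2 *: u) -> B (x + t *: u).
Proof.
move=> lB t12 B1 B2; have := lB _ _ ((t - t1) / (t2 - t1)) B1 B2.
suff -> : x + t1 *: u + ((t - t1) / (t2 - t1)) *: (x + t2 *: u - (x + t1 *: u))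
  = x + t *: u by [].
rewrite opprD addrACA subrr add0r -scalerBl scalerA divfK ?subr_eq0 1?eq_sym //.
by rewrite -addrA -scalerDl [t1 + _]addrC subrK.
Qed.

(** A nonempty convex set is not covered by finitely many affine subspaces none
    of which contains it. *)
Lemma generic_point (I : finType) (Bs : I -> set V) (P : set V) :
  (forall x y t, 0 <= t <= 1 -> P x -> P y -> P (x + t *: (y - x))) ->
  P !=set0 -> (forall i, line_closed (Bs i)) ->
  (forall i, ~ (P `<=` Bs i)) -> exists2 q, P q & forall i, ~ Bs i q.
Proof.
move=> Pseg [p0 Pp0] lB PB.
suff gen (s : seq I) : exists2 q, P q & forall i, i \in s -> ~ Bs i q.
  have [q Pq qB] := gen (enum I); exists q => // i.
  by apply: qB; rewrite mem_enum.
elim: s => [|i s [q Pq qs]]; first by exists p0.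
have [y Py yi] : exists2 y, P y & ~ Bs i y.
  apply: contrapT => nP; apply: (PB i) => y Py; apply: contrapT => yB.
  by apply: nP; exists y.
pose e n : R := n.+1%:R^-1.
apply: contrapT => nP.
(* Infinitely many points of the segment from [q] to [y] would lie in a single
   bad subspace, which would then contain both [q] and [y]. *)
have [|j jP] := @pigeonhole I (fun j n => j \in i :: s /\
    Bs j (q + e n *: (y - q))).
  move=> n; apply: contrapT => /forallNP nB; apply: nP.
  exists (q + e n *: (y - q)); last by move=> j js Bj; apply: (nB j).
  by apply: Pseg => //; rewrite invr_ge0 ler0n invf_le1 ?ltr0n // ler1n.
have [n1 _ [js B1]] := jP 0; have [n2 n12 [_ B2]] := jP n1.+1.
have e12 : e n1 != e n2.
  by rewrite (inj_eq invr_inj) eqr_nat eqSS ltn_eqF.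
have Bt t := line_closedP t (lB j) e12 B1 B2.
move: js; rewrite inE => /orP[/eqP ji|js].
  by apply: yi; have := Bt 1; rewrite scale1r addrC subrK ji.
by apply: (qs j js); have := Bt 0; rewrite scale0r addr0.
Qed.

End Faces.

(** * Geometric simplicial complexes *)

Section Complexes.
Variables (R : realType) (m : nat).
Local Notation V := 'rV[R]_m.

(** [l] is the system of barycentric coordinates of a point in the relative
    interior of the simplex with vertex set [A]. *)
Definition inner (T : finType) (A : {set T}) (l : T -> R) :=
  wts A l /\ forall i, i \in A -> 0 < l i.

(** A geometric simplicial complex on a finite set of vertices, encoded by the
    vertex sets of its simplices: [A] in [K] stands for the simplex [conv w A].
    By [gc_meet] two simplices meet in a common face. *)
Record geom_complex (T : finType) (w : T -> V) (K : {set {set T}}) : Prop :=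
  GeomComplex {
    gc_indep : forall A, A \in K -> indep w A;
    gc_down : forall A B : {set T}, A \in K -> B \subset A -> B \in K;
    gc_meet : forall A B : {set T}, A \in K -> B \in K ->
      conv w A `&` conv w B `<=` conv w (A :&: B)%SET }.

(** [K] is a geometric simplicial complex with union [F]. *)
Record triangulates (T : finType) (w : T -> V) (K : {set {set T}})
    (F : set V) : Prop := Triangulates {
  tr_complex : geom_complex w K;
  tr_cover : forall x, F x <-> exists2 A, A \in K & conv w A x }.

(** The simplex [A] lies in [F] but in no proper face of [F]; for a nonempty
    simplex of a polytope this means that its relative interior is contained in
    that of [F]. *)
Definition carried (T : finType) (w : T -> V) (F : set V) (A : {set T}) : Prop :=
  conv w A `<=` F /\ forall G, is_face F G -> conv w A `<=` G -> G = F.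

Lemma inner_nneg (T : finType) (A : {set T}) l : inner A l -> nneg l.
Proof.
move=> [[lA _] l0] i; have [/l0/ltW//|/lA ->//] := boolP (i \in A).
Qed.

Lemma inner_ex (T : finType) (A : {set T}) : A != finset.set0 ->
  exists l, inner A l.
Proof.
move=> A0; exists (fun i => (i \in A)%:R / #|A|%:R); split; last first.
  by move=> i ->; rewrite mul1r invr_gt0 ltr0n card_gt0.
split=> [i /negPf ->|]; first by rewrite mul0r.
rewrite -mulr_suml -natr_sum -big_mkcond /= sum1_card mulfV //.
by rewrite pnatr_eq0 cards_eq0.
Qed.

Lemma inner_conv (T : finType) (w : T -> V) (A : {set T}) l :
  inner A l -> conv w A (lin w l).
Proof. by move=> lA; exists l; split=> //; [case: lA|apply: inner_nneg lA]. Qed.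

Lemma inner_face (T : finType) (w : T -> V) (F G : set V) (A : {set T}) l :
  is_face F G -> conv w A `<=` F -> inner A l -> G (lin w l) ->
  forall i, i \in A -> G (w i).
Proof.
move=> fG AF lA Gl i iA; apply: (face_supp fG (proj1 lA) (inner_nneg lA)) => //.
  by move=> j jA; apply/AF/conv_vertex.
by rewrite gt_eqF // (proj2 lA).
Qed.

Lemma face_conv_sub (T : finType) (w : T -> V) (F G : set V) (A : {set T}) :
  is_face F G -> conv w A `<=` F -> (forall i, i \in A -> G (w i)) ->
  conv w A `<=` G.
Proof.
move=> [c [b [cF GE]]] AF AG x [l [lA l0 ->]]; rewrite GE; split.
  by apply: AF; exists l.
rewrite -/(dot _ _) dot_lin (sum_wts _ lA).
rewrite (eq_bigr (fun i => l i * b)) => [|i iA].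
  by rewrite -(sum_wts (fun=> b) lA) -mulr_suml (proj2 lA) mul1r.
by have := AG i iA; rewrite GE => -[_ <-].
Qed.

Section OneComplex.
Variables (T : finType) (w : T -> V) (K : {set {set T}}).
Hypothesis cK : geom_complex w K.
Implicit Types (A B S : {set T}) (l : T -> R).

(** A point of the union has only one system of barycentric coordinates, whatever
    simplex it is computed in. *)
Lemma coords_uniq A B l l' : A \in K -> B \in K ->
  wts A l -> nneg l -> wts B l' -> nneg l' -> lin w l = lin w l' -> l =1 l'.
Proof.
move=> AK BK lA l0 lB l0' ll.
have [|k [kAB _ lk]] := gc_meet cK AK BK (t := lin w l).
  by split; [exists l|exists l'].
have kA : wts A k by apply: wts_sub kAB; apply: subsetIl.
have kB : wts B k by apply: wts_sub kAB; apply: subsetIr.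
move=> i; rewrite (indep_inj (gc_indep cK AK) lA kA lk).
by rewrite (indep_inj (gc_indep cK BK) lB kB) // -ll.
Qed.

Lemma inner_subset A S l : A \in K -> S \in K -> inner A l ->
  conv w S (lin w l) -> A \subset S.
Proof.
move=> AK SK lA [k [kS k0 lk]]; apply/fintype.subsetP => i iA.
apply: contraLR (proj2 lA i iA) => /(proj1 kS) ki.
by rewrite (coords_uniq AK SK (proj1 lA) (inner_nneg lA) kS) // ki ltxx.
Qed.

Lemma inner_uniq A B l l' : A \in K -> B \in K -> inner A l -> inner B l' ->
  lin w l = lin w l' -> A = B.
Proof.
move=> AK BK lA lB ll; apply/eqP; rewrite finset.eqEsubset; apply/andP; split.
  by apply: (inner_subset AK BK lA); rewrite ll; apply: inner_conv.
by apply: (inner_subset BK AK lB); rewrite -ll; apply: inner_conv.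
Qed.

Lemma conv_inj A B : A \in K -> B \in K -> conv w A = conv w B -> A = B.
Proof.
wlog suff sub : A B / A \in K -> B \in K -> conv w A = conv w B -> A \subset B.
  move=> AK BK AB; apply/eqP; rewrite finset.eqEsubset.
  by rewrite !sub.
move=> AK BK AB; have [->|/inner_ex[l lA]] := eqVneq A finset.set0.
  exact: finset.sub0set.
by apply: (inner_subset AK BK lA); rewrite -AB; apply: inner_conv.
Qed.

Lemma inner_coords A x : A \in K -> conv w A x ->
  exists S l, [/\ S \in K, S \subset A, inner S l & x = lin w l].
Proof.
move=> AK [l [lA l0 ->]]; pose S := [set i | l i != 0]%SET.
have SA : S \subset A.
  by apply/fintype.subsetP => i; rewrite inE; apply: contraNT => /(proj1 lA) ->.
exists S, l; split=> //; first exact: gc_down cK _ _ AK SA.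
split; last by move=> i; rewrite inE lt_def l0 andbT.
by split; last exact: (proj2 lA); move=> i; rewrite inE negbK => /eqP.
Qed.

Lemma vertex_mem t A : [set t]%SET \in K -> A \in K -> conv w A (w t) -> t \in A.
Proof.
move=> tK AK; rewrite -(lin_delta w t) => At; rewrite -finset.sub1set.
apply: inner_subset At => //; split; first by apply: wts_delta; rewrite inE.
by move=> i; rewrite inE => ->.
Qed.

End OneComplex.

Lemma limit_nneg (a b : R) :
  (forall N, exists2 n, (N <= n)%N & 0 <= a + n.+1%:R^-1 * b) -> 0 <= a.
Proof.
move=> ab; rewrite leNgt; apply/negP => a0.
have [n nN] := ab (Num.truncn (b / - a)); apply/negP; rewrite -ltNge.
have bn : b / - a < n.+1%:R.
  by apply: lt_le_trans (Num.Theory.truncnS_gt _) _; rewrite ler_nat.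
move: bn; rewrite ltr_pdivrMr ?oppr_gt0 // -ltr_pdivrMl ?ltr0n //.
by move: (_^-1 * b) => z; lra.
Qed.

(** Small positive steps from [u] in direction [v] have positive coordinates. *)
Lemma small_step (T : finType) (S : {set T}) (u v : T -> R) :
  (forall i, i \in S -> 0 < u i \/ (u i = 0 /\ 0 < v i)) ->
  exists2 e0 : R, 0 < e0 &
    forall e, 0 < e <= e0 -> forall i, i \in S -> 0 < u i + e * v i.
Proof.
move=> uv.
have /choice[f fP] i : exists d : R, i \in S -> 0 < d /\
    forall e, 0 < e <= d -> 0 < u i + e * v i.
  have [iS|_] := boolP (i \in S); last by exists 0.
  have [ui|[-> vi]] := uv i iS; last first.
    by exists 1 => _; split=> // e /andP[e0 _]; rewrite add0r mulr_gt0.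
  have v1 : 0 < `|v i| + 1 by rewrite ltr_wpDl.
  exists (u i / (`|v i| + 1)) => _; split=> [|e /andP[e0]].
    by rewrite divr_gt0.
  rewrite ler_pdivlMr // mulrDr mulr1 => ee.
  have : e * - v i <= e * `|v i|.
    by rewrite ler_wpM2l ?(ltW e0) // -normrN ler_norm.
  by rewrite mulrN; lra.
exists (\big[Num.min/1]_(i in S) f i).
  apply: (big_ind (fun x => 0 < x)) => // [x y x0 y0|i /fP[]//].
  by rewrite lt_min x0.
move=> e /andP[e0 ef] i iS; apply: (proj2 (fP i iS)); rewrite e0 /=.
by rewrite (le_trans ef) // (bigD1 i) //= ge_min lexx.
Qed.

End Complexes.

(** * The half-open decomposition of a triangulated convex set *)

Section HalfOpen.
Variables (R : realType) (m : nat).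
Local Notation V := 'rV[R]_m.
Variables (T : finType) (w : T -> V) (K : {set {set T}}) (F : set V) (k : nat).
Hypothesis trF : triangulates w K F.
Hypothesis segF :
  forall x y (t : R), 0 <= t <= 1 -> F x -> F y -> F (x + t *: (y - x)).
Hypothesis dimF : has_dim F k.
Implicit Types (A B S : {set T}) (l : T -> R).

Let cK := tr_complex trF.

(** [S] is a simplex of [K] of the dimension [k] of [F]. *)
Definition top S := (S \in K) && (#|S| == k.+1).

Lemma triangulates_sub S : S \in K -> conv w S `<=` F.
Proof. by move=> SK x Sx; apply/(tr_cover trF); exists S. Qed.

Lemma has_dim_face_simplex S : S \in K -> S != finset.set0 ->
  has_dim (conv w S) #|S|.-1.
Proof. by move=> SK; apply: has_dim_simplex; apply: gc_indep cK _ SK. Qed.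

Lemma card_simplex S : S \in K -> (#|S| <= k.+1)%N.
Proof.
move=> SK; have [->|S0] := eqVneq S finset.set0; first by rewrite cards0.
have : (#|S|.-1 <= k)%N.
  apply: has_dim_mono (has_dim_face_simplex SK S0) dimF.
  exact/aff_hull_sub/triangulates_sub.
by case: #|S|.
Qed.

Lemma top_dim S : top S -> has_dim (conv w S) k.
Proof.
move=> /andP[SK /eqP Sk]; have := has_dim_face_simplex SK.
by rewrite Sk; apply; rewrite -cards_eq0 Sk.
Qed.

Lemma top_aff S : top S -> aff w S = aff_hull F.
Proof.
move=> tS; rewrite -aff_hull_conv; apply: has_dim_aff_hull (top_dim tS) dimF.
by apply: triangulates_sub; case/andP: tS.
Qed.

Lemma low_aff A : (#|A| <= k)%N -> A \in K -> ~ (F `<=` aff w A).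
Proof.
move=> Ak AK FA; have [x Fx] := has_dim_neq0 dimF.
have A0 : A != finset.set0.
  apply/eqP => A0; have [l /wts_neq0[i]] := FA x Fx.
  by rewrite A0 inE.
have : (k <= #|A|.-1)%N.
  apply: has_dim_mono dimF (has_dim_face_simplex AK A0).
  rewrite aff_hull_conv => y [n [p [c [pF c1 ->]]]].
  apply: (@aff_lin _ _ _ _ _ [set: 'I_n]%SET) => [|j _]; last exact: FA.
  by split=> // i; rewrite inE.
by move: Ak A0; rewrite -card_gt0; lia.
Qed.

(** [q] is a point of [F] outside the affine hull of every simplex of dimension
    less than [k]. *)
Definition generic q := F q /\ forall A, A \in K -> (#|A| <= k)%N -> ~ aff w A q.

Lemma generic_ex : exists q, generic q.
Proof.
pose Bs A : set V := [set x | [/\ A \in K, (#|A| <= k)%N & aff w A x]].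
have [q Fq qB] : exists2 q, F q & forall A, ~ Bs A q.
  apply: generic_point segF (has_dim_neq0 dimF) _ _.
    move=> A x y t [AK Ak Ax] [_ _ Ay]; split=> //; exact: aff_line.
  move=> A FB; have [x /FB[AK Ak _]] := has_dim_neq0 dimF.
  by apply: (low_aff Ak AK) => y /FB[].
by exists q; split=> // A AK Ak Aq; apply: (qB A).
Qed.

Section Generic.
(* For a top simplex [S], [lq S] is the system of barycentric coordinates of
   [q] with respect to [S]. *)
Variables (q : V) (lq : {set T} -> T -> R).
Hypothesis gq : generic q.
Hypothesis lqP : forall S, top S -> [/\ wts S (lq S), q = lin w (lq S) &
  forall i, i \in S -> lq S i != 0].

(** If a small step from an inner point [x] of the simplex [A] in direction
    [s (q - x)] stays in [F], it enters the interior of a top simplex [S]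
    containing [A], for which the coordinates of [q] at the vertices outside [A]
    have the sign of [s]. *)
Lemma step_ex A l (s e : R) : A \in K -> inner A l -> s != 0 -> 0 < e ->
  F (lin w l + (e * s) *: (q - lin w l)) ->
  exists S, [/\ top S, A \subset S &
    forall i, i \in S -> i \notin A -> 0 < s * lq S i].
Proof.
move=> AK lA s0 e0; set x := lin w l => Fe.
have Fx : F x by apply: (triangulates_sub AK); apply: inner_conv.
have seg n : exists S, S \in K /\ conv w S (x + (n.+1%:R^-1 * e * s) *: (q - x)).
  have := segF (t := n.+1%:R^-1) _ Fx Fe.
  rewrite [x + _ - x]addrAC subrr add0r scalerA mulrA => /(_ _)/(tr_cover trF).
  case; first by rewrite invr_ge0 ler0n invf_le1 ?ltr0n // ler1n.
  by move=> S SK Sx; exists S.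
(* Some simplex [S] contains points of the segment arbitrarily close to [x];
   being affine along the segment, the coordinates in [S] are then nonnegative
   at [x] itself. *)
have [S SP] := pigeonhole seg; exists S.
have [n1 _ [SK S1]] := SP 0%N; have [n2 n12 [_ S2]] := SP n1.+1.
have e12 : n1.+1%:R^-1 * e * s != n2.+1%:R^-1 * e * s.
  have es : e * s != 0 by rewrite mulf_neq0 // gt_eqF.
  rewrite -!mulrA (inj_eq (mulIf es)).
  by rewrite (inj_eq invr_inj) eqr_nat eqSS ltn_eqF.
have Saff t := line_closedP t (@aff_line _ _ _ w S) e12 (conv_aff S1) (conv_aff S2).
have Sq : aff w S q by have := Saff 1; rewrite scale1r addrC subrK.
have tS : top S.
  rewrite /top SK eqn_leq card_simplex //= ltnNge; apply/negP => Sk.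
  exact: (proj2 gq) Sk Sq.
have [lS qS lS0] := lqP tS.
have [lx lxS xE] : aff w S x by have := Saff 0; rewrite scale0r addr0.
have lxP n : conv w S (x + (n.+1%:R^-1 * e * s) *: (q - x)) ->
    forall i, 0 <= lx i + n.+1%:R^-1 * (e * (s * (lq S i - lx i))).
  move=> [k' [kS k0]]; rewrite xE qS -lin_line => kE i; rewrite !mulrA.
  by rewrite (indep_inj (gc_indep cK SK) (wts_line _ lxS lS) kS kE).
have lx0 : nneg lx.
  move=> i; apply: limit_nneg => N; have [n Nn [_ /lxP Sn]] := SP N.
  by exists n => //; apply: Sn.
have lxl : lx =1 l.
  by apply: (coords_uniq cK SK AK) => //; [case: lA|apply: inner_nneg lA].
have AS : A \subset S.
  by apply: (inner_subset cK AK SK lA); exists lx.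
split=> // i iS iA; rewrite lt_def mulf_neq0 ?lS0 //=.
have := lxP _ S1 i; rewrite lxl (proj1 (proj1 lA)) // subr0 add0r.
by rewrite pmulr_rge0 ?invr_gt0 ?ltr0n // pmulr_rge0.
Qed.

Lemma step_inner A l (s : R) S : inner A l -> top S -> A \subset S ->
  (forall i, i \in S -> i \notin A -> 0 < s * lq S i) ->
  exists2 e0, 0 < e0 & forall e, 0 < e <= e0 ->
    inner S (fun i => l i + (e * s) * (lq S i - l i)).
Proof.
move=> [lA l0] tS AS sS; have [lS _ _] := lqP tS.
have [i iS|e0 e00 eP] := @small_step _ _ S l (fun i => s * (lq S i - l i)).
  have [/l0|iA] := boolP (i \in A); first by left.
  by right; rewrite (proj1 lA) // subr0; split=> //; apply: sS.
exists e0 => // e ee; split; first exact: wts_line (wts_sub AS lA) lS.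
by move=> i iS; rewrite -mulrA; apply: eP.
Qed.

Lemma step_uniq A l (s : R) S S' : inner A l ->
  top S -> A \subset S -> (forall i, i \in S -> i \notin A -> 0 < s * lq S i) ->
  top S' -> A \subset S' ->
  (forall i, i \in S' -> i \notin A -> 0 < s * lq S' i) -> S = S'.
Proof.
move=> lA tS AS sS tS' AS' sS'.
have [e1 e10 e1P] := step_inner lA tS AS sS.
have [e2 e20 e2P] := step_inner lA tS' AS' sS'.
have e12 : 0 < Num.min e1 e2 by rewrite lt_min e10.
have S1 := e1P (Num.min e1 e2); have S2 := e2P (Num.min e1 e2).
apply: (inner_uniq cK _ _ (S1 _) (S2 _)).
- by case/andP: tS.
- by case/andP: tS'.
- by rewrite e12 ge_min lexx.
- by rewrite e12 ge_min lexx orbT.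
have [_ qS _] := lqP tS; have [_ qS' _] := lqP tS'.
by rewrite !lin_line -qS -qS'.
Qed.

Lemma top_face S G : top S -> is_face F G -> conv w S `<=` G -> G = F.
Proof.
move=> tS fG SG; apply/seteqP; split; first exact: face_subset fG.
have [c [b [cF GE]]] := fG; move=> x Fx; rewrite GE; split=> //.
have : aff w S x by rewrite top_aff //; apply: sub_aff_hull.
move=> [l lS ->]; rewrite -/(dot _ _) dot_lin (sum_wts _ lS).
rewrite (eq_bigr (fun i => l i * b)) => [|i iS].
  by rewrite -(sum_wts (fun=> b) lS) -mulr_suml (proj2 lS) mul1r.
have : G (w i) by apply/SG/conv_vertex.
by rewrite GE => -[_ <-].
Qed.

Lemma generic_top : exists S l, [/\ top S, inner S l & q = lin w l].
Proof.
have [A AK Aq] := (tr_cover trF q).1 (proj1 gq).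
have [S [l [SK SA lS qE]]] := inner_coords cK AK Aq.
exists S, l; split=> //; rewrite /top SK eqn_leq card_simplex //= ltnNge.
apply/negP => Sk.
by apply: (proj2 gq) SK Sk _; rewrite qE; apply/conv_aff/inner_conv.
Qed.

(** A generic point lies in no proper face. *)
Lemma generic_face G : is_face F G -> G q -> G = F.
Proof.
move=> fG Gq; have [S [l [tS lS qE]]] := generic_top.
have SF := triangulates_sub (andP tS).1.
apply: (top_face tS fG); apply: (face_conv_sub fG SF) => i.
by apply: (inner_face fG SF lS); rewrite -qE.
Qed.

(** Half-open decomposition of the complex, obtained with steps towards [q]: for
    every nonempty simplex [A] there is a top simplex [S] containing [A] such that
    [q] has positive coordinates at the vertices of [S] outside [A]; by
    [half_open_uniq] it is unique. *)
Lemma half_open A : A \in K -> A != finset.set0 ->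
  exists S, [/\ top S, A \subset S &
    forall i, i \in S -> i \notin A -> 0 < lq S i].
Proof.
move=> AK /(@inner_ex R)[l lA].
have [|S [tS AS sS]] := step_ex AK lA (oner_neq0 R) ltr01.
  by rewrite mulr1 scale1r addrC subrK; case: gq.
by exists S; split=> // i iS iA; rewrite -[lq _ _]mul1r sS.
Qed.

Lemma half_open_uniq A S S' : A != finset.set0 ->
  top S -> A \subset S -> (forall i, i \in S -> i \notin A -> 0 < lq S i) ->
  top S' -> A \subset S' -> (forall i, i \in S' -> i \notin A -> 0 < lq S' i) ->
  S = S'.
Proof.
move=> /(@inner_ex R)[l lA] tS AS sS tS' AS' sS'.
have pos1 S1 : (forall i, i \in S1 -> i \notin A -> 0 < lq S1 i) ->
    forall i, i \in S1 -> i \notin A -> 0 < 1 * lq S1 i.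
  by move=> sS1 i iS iA; rewrite mul1r sS1.
exact: step_uniq lA tS AS (pos1 S sS) tS' AS' (pos1 S' sS').
Qed.

(** The case of the empty simplex: some top simplex contains [q] in its interior;
    it is unique by [half_open0_uniq]. *)
Lemma half_open0 : exists S, top S /\ forall i, i \in S -> 0 < lq S i.
Proof.
have [S [l [tS lS qE]]] := generic_top.
have [lqS qS _] := lqP tS; have /andP[SK _] := tS.
exists S; split=> // i iS; rewrite (indep_inj (gc_indep cK SK) lqS (proj1 lS)).
  exact: (proj2 lS).
by rewrite -qS.
Qed.

Lemma half_open0_uniq S S' : top S -> (forall i, i \in S -> 0 < lq S i) ->
  top S' -> (forall i, i \in S' -> 0 < lq S' i) -> S = S'.
Proof.
move=> tS sS tS' sS'.
have [lS qS _] := lqP tS; have [lS' qS' _] := lqP tS'.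
apply: (inner_uniq cK (l := lq S) (l' := lq S')).
- by case/andP: tS.
- by case/andP: tS'.
- by split.
- by split.
by rewrite -qS.
Qed.

(** Half-open decomposition of the simplices carried by [F], obtained with steps
    away from [q]. *)
Lemma half_open_interior A : A != finset.set0 -> A \in K ->
  (forall x, F x -> (exists2 e : R, 0 < e & F (x - e *: (q - x))) \/
     exists G, [/\ is_face F G, G x & ~ G q]) ->
  carried w F A <->
  exists S, [/\ top S, A \subset S &
    forall i, i \in S -> i \notin A -> lq S i < 0].
Proof.
move=> /(@inner_ex R)[l lA] AK prolong.
have [Fq _] := gq.
have Al : conv w A (lin w l) by apply: inner_conv.
split=> [[AF Aface]|[S [tS AS sS]]].
  have [[e e0 Fe]|[G [fG Gl Gq]]] := prolong (lin w l) (AF _ Al); last first.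
    case: Gq; rewrite (Aface G fG) //.
    by apply: (face_conv_sub fG AF) => i; apply: (inner_face fG AF lA).
  have [||S [tS AS sS]] := @step_ex A l (-1) e AK lA _ e0.
  - by rewrite oppr_eq0 oner_neq0.
  - by rewrite mulrN1 scaleNr.
  exists S; split=> // i iS iA.
  by rewrite -oppr_gt0 -mulN1r sS.
split=> [|G fG AG]; first exact: triangulates_sub.
apply: (generic_face fG).
have [i iS iA|e0 e00 /(_ e0)] := step_inner (s := -1) lA tS AS _.
  by rewrite mulN1r oppr_gt0 sS.
rewrite e00 lexx => /(_ isT) /(inner_conv w).
have [_ qS _] := lqP tS.
rewrite lin_line -qS mulrN1 => /(triangulates_sub (andP tS).1).
have [c [b [cF GE]]] := fG; move/cF.
have : G (lin w l) by apply: AG.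
rewrite GE => -[Fl lb]; rewrite -!/(dot _ _) in lb *.
rewrite dotDl dotZl dotBl lb; have := cF _ Fq; rewrite -/(dot _ _) => qb.
rewrite gerDl mulNr oppr_le0 pmulr_rge0 // subr_ge0 => bq.
by split=> //; apply/eqP; rewrite eq_le qb.
Qed.

End Generic.

Lemma generic_coords q : generic q -> exists lq : {set T} -> T -> R,
  forall S, top S -> [/\ wts S (lq S), q = lin w (lq S) &
    forall i, i \in S -> lq S i != 0].
Proof.
move=> [Fq gq].
suff /choice[lq lqP] S : exists l, top S -> [/\ wts S l, q = lin w l &
    forall i, i \in S -> l i != 0] by exists lq.
have [tS|_] := boolP (top S); last by exists (fun=> 0).
have : aff w S q by rewrite top_aff //; apply: sub_aff_hull.
move=> [l lS qE]; exists l => _; split=> // i iS.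
have /andP[SK /eqP Sk] := tS.
apply/eqP => li; apply: (gq (S :\ i)%SET).
- by apply: gc_down cK _ _ SK _; apply: finset.subD1set.
- by move: Sk; rewrite (cardsD1 i) iS add1n => -[->].
exists l => //; split; last exact: (proj2 lS).
move=> j; rewrite in_setD1 negb_and negbK => /orP[/eqP -> //|].
exact: (proj1 lS).
Qed.

End HalfOpen.

(** * Counting over intervals of subsets *)

Section Counting.

Lemma sum_interval (T : finType) (N S : {set T}) (g : nat -> int) : N \subset S ->
  \sum_(A : {set T} | (N \subset A) && (A \subset S)) g #|A| =
  \sum_(t < (#|S| - #|N|).+1) ('C(#|S| - #|N|, t))%:Z * g (#|N| + t)%N.
Proof.
move=> NS; pose D := (S :\: N)%SET.
have cD : (#|S| - #|N|)%N = #|D| by rewrite cardsD (finset.setIidPr NS).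
have disj (B : {set T}) : B \subset D -> (N :&: B = finset.set0)%SET.
  move=> BD; apply/setP => x; move: (fintype.subsetP BD x); rewrite !inE.
  by case: (x \in N); case: (x \in B) => //= /(_ isT).
have sub (A : {set T}) : N \subset A -> (N :|: (A :\: N) = A)%SET.
  move=> NA; apply/setP => x; move: (fintype.subsetP NA x); rewrite !inE.
  by case: (x \in N) => //= ->.
rewrite (reindex_onto (fun B : {set T} => N :|: B)%SET (fun A => A :\: N)%SET);
  last by move=> A /andP[/sub].
rewrite cD (eq_bigl (fun B : {set T} => B \subset D)); last first.
  move=> B; rewrite finset.subsetUl finset.subUset NS /=.
  have -> : ((N :|: B) :\: N = B :\: N)%SET.
    by apply/setP => x; rewrite !inE; case: (x \in N).
  rewrite finset.subsetD; apply: andb_id2l => _.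
  by apply/eqP/idP => /finset.setDidPl.
rewrite (partition_big (fun B : {set T} => inord #|B| : 'I_#|D|.+1) predT) //=.
apply: eq_bigr => t _.
have -> : ('C(#|D|, t))%:Z = \sum_(B : {set T} | (B \subset D) && (#|B| == t)) 1.
  rewrite -cards_draws -sum1_card -natz natr_sum.
  by apply: eq_bigl => B; rewrite inE.
rewrite mulr_suml.
have BDc (B : {set T}) : B \subset D -> (#|B| < #|D|.+1)%N.
  by move=> BD; rewrite ltnS subset_leq_card.
apply: eq_big => [B|B].
  apply: andb_id2l => BD.
  by rewrite -(inj_eq val_inj) /= inordK // BDc.
move=> /andP[BD /eqP <-]; rewrite mul1r cardsU disj // cards0 subn0.
by rewrite inordK // BDc.
Qed.

(** If the intervals [[N S, S]], for [S] in [tops], partition [P], a sum over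
    [P] splits accordingly. *)
Lemma sum_partition (T : finType) (P tops : pred {set T}) (N : {set T} -> {set T})
    (g : {set T} -> int) :
  (forall A : {set T}, P A ->
    exists S : {set T}, [/\ tops S, N S \subset A & A \subset S]) ->
  (forall A S S' : {set T}, P A -> tops S -> N S \subset A -> A \subset S ->
    tops S' -> N S' \subset A -> A \subset S' -> S = S') ->
  (forall A S : {set T}, tops S -> N S \subset A -> A \subset S -> P A) ->
  \sum_(A | P A) g A =
  \sum_(S | tops S) \sum_(A : {set T} | (N S \subset A) && (A \subset S)) g A.
Proof.
move=> ex uniq back.
rewrite (exchange_big_dep P) /=; last by move=> S A tS /andP[]; apply: back.
apply: eq_bigr => A PA; have [S [tS NA AS]] := ex A PA.
rewrite (big_pred1 S) // => S' /=; apply/andP/eqP => [[tS' /andP[NA' AS']]|->].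
  exact: uniq PA tS' NA' AS' tS NA AS.
by rewrite NA AS.
Qed.

Lemma bin_trinomial D J t : (t <= J)%N -> (J <= D)%N ->
  ('C(D, t) * 'C(D - t, D - J) = 'C(D, J) * 'C(J, t))%N.
Proof.
move=> tJ JD.
have f0 n : (0 < n`!)%N by exact: fact_gt0.
have h1 := bin_fact (leq_trans tJ JD).
have h2 := bin_fact (leq_sub2l D tJ).
have h3 := bin_fact JD.
have h4 := bin_fact tJ.
have -> : 'C(D - t, D - J) = 'C(D - t, J - t).
  by rewrite -bin_sub ?leq_sub2l //; congr 'C(_, _); lia.
have h5 : ('C(D - t, J - t) * ((J - t)`! * (D - J)`!) = (D - t)`!)%N.
  rewrite -(@bin_fact (D - t) (J - t)); last by lia.
  by have -> : (D - t - (J - t) = D - J)%N by lia.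
apply/eqP; rewrite -(eqn_pmul2r (f0 t)) -(eqn_pmul2r (f0 (J - t)%N)).
rewrite -(eqn_pmul2r (f0 (D - J)%N)); apply/eqP.
transitivity D`!; first by rewrite -h1 -h5; ring.
by rewrite -h3 -h4; ring.
Qed.

(** The contribution of an interval [[N, S]] with [#|N| = a] and [#|S| = D] to
    the [j]-th entry of the h-vector. *)
Lemma hvec_interval D a j : (a <= D)%N -> (j <= D)%N ->
  \sum_(t < (D - a).+1) ('C(D - a, t))%:Z *
    (if (a + t <= j)%N then
       (-1) ^+ (j - (a + t)) * ('C(D - (a + t), D - j))%:Z else 0) =
  (a == j)%:R :> int.
Proof.
move=> aD jD; have [ja|aj] := ltnP j a.
  rewrite big1 => [|t _]; first by rewrite gtn_eqF.
  by rewrite ifN ?mulr0 // -ltnNge; lia.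
pose E := (D - a)%N; pose J := (j - a)%N.
have JE : (J <= E)%N by rewrite /J /E; lia.
transitivity (\sum_(t < E.+1) (if (t <= J)%N then
    ('C(E, J))%:Z * ((-1) ^+ (J - t) * ('C(J, t))%:Z) else 0 : int)).
  apply: eq_bigr => t _.
  have -> : (a + t <= j)%N = (t <= J)%N by rewrite /J; lia.
  case: leqP => tJ; last by rewrite mulr0.
  have -> : (D - (a + t) = E - t)%N by rewrite /E; lia.
  have -> : (D - j = E - J)%N by rewrite /E /J; lia.
  have -> : (j - (a + t) = J - t)%N by rewrite /J; lia.
  rewrite mulrCA [RHS]mulrCA; congr (_ * _).
  by rewrite -!PoszM bin_trinomial.
rewrite -big_mkcond /=.
have JE1 : (J.+1 <= E.+1)%N by [].
rewrite -(big_ord_widen _ (fun t => ('C(E, J))%:Z *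
  ((-1) ^+ (J - t) * ('C(J, t))%:Z)) JE1) -mulr_sumr.
have -> : \sum_(t < J.+1) (-1) ^+ (J - t) * ('C(J, t))%:Z = (-1 + 1) ^+ J :> int.
  rewrite exprDn; apply: eq_bigr => t _.
  by rewrite expr1n mulr1 -mulr_natr natz.
rewrite addrC subrr expr0n /J subn_eq0.
have [->|ajn] := eqVneq a j; first by rewrite leqnn subnn bin0.
by rewrite leqNgt ltn_neqAle ajn aj mulr0.
Qed.

Lemma vandermonde_interval (a p d n : nat) : (0 < p)%N -> (a + p = d.+1)%N ->
  (\sum_(t < a.+1) 'C(a, t) * 'C(n, (p + t).-1) = 'C(a + n, d))%N.
Proof.
move=> p0 apd; rewrite -binomial.Vandermonde.
transitivity (\sum_(t < a.+1) 'C(a, t) * 'C(n, d - t))%N.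
  rewrite (reindex_inj rev_ord_inj) /=; apply: eq_bigr => t _.
  have ta : (t <= a)%N by rewrite -ltnS.
  rewrite subSS bin_sub //; congr ('C(_, _) * 'C(_, _))%N.
  by lia.
have ad : (a.+1 <= d.+1)%N by lia.
rewrite (big_ord_widen _ (fun t => 'C(a, t) * 'C(n, d - t))%N ad) big_mkcond /=.
apply: eq_bigr => t _; case: ltnP => // at_.
by rewrite bin_small.
Qed.

End Counting.

(** * From triangulations to complexes on a vertex set *)

Section Encoding.
Variables (R : realType) (m : nat).
Local Notation V := 'rV[R]_m.

Lemma finite_set_family (X : set V) : finite_set X ->
  exists (T : finType) (w : T -> V),
    injective w /\ forall x, X x <-> exists t, x = w t.
Proof.
move=> finX; exists (fset_set X : finType), val; split; first exact: val_inj.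
move=> x; split=> [Xx|[t ->]].
  have xX : x \in fset_set X by rewrite in_fset_set // inE.
  by exists [` xX]%fset.
by have := valP t; rewrite in_fset_set // inE.
Qed.

(** A triangulation is the same thing as a finite abstract simplicial complex on
    its set of vertices, realised in space. *)
Lemma triangulation_complex (P : set V) (C : set (set V)) : triangulation P C ->
  exists (T : finType) (w : T -> V) (K : {set {set T}}),
    triangulates w K P /\ forall S, C S <-> exists2 A, A \in K & S = conv w A.
Proof.
move=> trC; pose X := [set v | C [set v]].
have finX : finite_set X.
  have -> : X = (fun v => [set v]) @^-1` C by [].
  apply: finite_preimage; last exact: triang_finite trC.
  by move=> x y _ _ xy; have : [set y] x by rewrite -xy.
have [T [w [w_inj wX]]] := finite_set_family finX.
pose K := [set A : {set T} | `[< C (conv w A) /\ indep w A >]]%SET.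
have KP A : A \in K <-> C (conv w A) /\ indep w A.
  by rewrite inE; split=> [/asboolP|?]; [|apply/asboolP].
have CK S : C S <-> exists2 A, A \in K & S = conv w A.
  split=> [CS|[A /KP[CA _] -> //]].
  have [k [p [ip SE]]] := triang_simplex trC CS.
  have ip' : indep p [set: 'I_k]%SET by move=> c _; apply: ip.
  have SE' : S = conv p [set: 'I_k]%SET.
    rewrite SE; apply: conv_hullE => x; split=> [[i _ <-]|[i _ ->]].
      by exists i; rewrite ?inE.
    by exists i.
  have /choice[t tP] i : exists t, p i = w t.
    apply/wX; rewrite /X /= -conv1; apply: triang_face trC _ _ CS _.
    by rewrite SE'; apply: simplex_face => //; apply: finset.subsetT.
  have t_inj : injective t.
    move=> i j tij; apply/eqP; apply: contraT => ij.
    have := ip (fun h => (h == i)%:R - (h == j)%:R).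
    rewrite -/(lin p _) linB !lin_delta sumrB !sum_delta !tP tij !subrr.
    move=> /(_ erefl erefl i)/eqP.
    by rewrite eqxx (negPf ij) subr0 oner_eq0.
  have SA : S = conv w (t @: [set: 'I_k])%SET.
    rewrite SE; apply: conv_hullE => x; split.
      by move=> [i _ <-]; exists (t i); rewrite ?imset_f ?inE.
    by move=> [_ /imsetP[i _ ->] ->]; exists i.
  exists (t @: [set: 'I_k])%SET => //.
    apply/KP; split; first by rewrite -SA.
    move=> c cA c0 wc0.
    have sumE (U : nmodType) (f : T -> U) :
        (forall x, x \notin (t @: [set: 'I_k])%SET -> f x = 0) ->
        \sum_x f x = \sum_i f (t i).
      move=> fA; rewrite (bigID (mem (t @: [set: 'I_k])%SET)) /=.
      rewrite [X in _ + X]big1 // addr0 big_imset /=; last first.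
        by move=> ? ? _ _; apply: t_inj.
      by apply: eq_bigl => i; rewrite inE.
    have ct i : c (t i) = 0.
      apply: (ip (c \o t)); first by rewrite -[RHS]c0 sumE.
      rewrite -[RHS]wc0 /lin sumE => [|x /cA ->]; last by rewrite scale0r.
      by apply: eq_bigr => j _; rewrite tP.
    move=> x; have [/imsetP[i _ ->]|/cA //] := boolP (x \in (t @: [set: 'I_k])%SET).
    exact: ct.
exists T, w, K; split=> //; split; first split.
- by move=> A /KP[].
- move=> A B /KP[CA iA] BA; apply/KP; split; last exact: indep_sub BA iA.
  exact: triang_face trC _ _ CA (simplex_face iA BA).
(* The coordinates in [A] of a common point of the two simplices are used: a
   vertex [w i] of [A] with nonzero coordinate lies in [conv w B] and, since
   its singleton is a simplex of [C], it is a vertex of [B]. *)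
- move=> A B /KP[CA iA] /KP[CB iB] x [Ax Bx].
  have [l [lA l0 xl]] := Ax.
  exists l; split=> //; split; last exact: (proj2 lA).
  move=> i; rewrite inE negb_and => iAB; apply/eqP; apply: contraT => li.
  have iA' : i \in A by apply: contraNT li => /(proj1 lA) ->.
  have [fA _] := triang_meet trC CA CB.
  have [|_ Bwi] := face_supp fA lA l0 (@conv_vertex _ _ _ w A) _ li.
    by rewrite -xl.
  have Cwi : C [set w i] by apply/wX; exists i.
  have [fB _] := triang_meet trC CB Cwi.
  have [l' [lB l0' wil]] := Bwi.
  have [j jB lj] := wts_neq0 lB.
  have [|_ /w_inj ji] := face_supp fB lB l0' (@conv_vertex _ _ _ w B) _ lj.
    by rewrite -wil.
  by move: iAB; rewrite iA' -ji jB.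
- move=> x; rewrite -(triang_cover trC); split=> [[S /CK[A AK ->] Ax]|[A AK Ax]].
    by exists A.
  by exists (conv w A) => //; apply/CK; exists A.
Qed.

Lemma polytope_family (P : set V) : is_polytope P ->
  exists (T : finType) (a : T -> V), P = conv a [set: T]%SET.
Proof.
move=> [X finX ->]; have [T [a [_ aX]]] := finite_set_family finX.
exists T, a; apply: conv_hullE => x; rewrite aX.
by split=> [[t ->]|[t _ ->]]; exists t; rewrite ?inE.
Qed.

End Encoding.

(** * Faces carrying simplices *)

Section FaceSums.
Variables (R : realType) (m : nat).
Local Notation V := 'rV[R]_m.
Variables (U : finType) (a : U -> V) (P : set V).
Hypothesis PE : P = conv a [set: U]%SET.
Variables (T : finType) (w : T -> V) (K : {set {set T}}).
Hypothesis trP : triangulates w K P.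
Implicit Types (A B S : {set T}) (F G : set V).

Let cK := tr_complex trP.

(** [P] being the convex hull of the family [a], the members of the family that
    lie in [F]; a face [F] is the convex hull of these, so there are finitely
    many faces. *)
Definition face_verts F : {set U} := [set i | `[< F (a i) >]]%SET.

Lemma face_polytope F : is_face P F -> F = conv a (face_verts F).
Proof.
rewrite PE => /face_conv {1}->; congr (conv a _).
by apply/setP => i; rewrite !inE.
Qed.

Lemma face_of_face F G : is_face P F -> is_face F G -> is_face P G.
Proof. by rewrite PE; apply: face_trans. Qed.

Lemma face_verts_lt F G : is_face P F -> is_face F G -> G <> F ->
  (#|face_verts G| < #|face_verts F|)%N.
Proof.
move=> fF fG GF; have fG' := face_of_face fF fG.
rewrite ltnNge; apply/negP => le; apply: GF.
rewrite (face_polytope fG') (face_polytope fF); congr (conv a _).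
apply/eqP; rewrite eqEcard le andbT; apply/fintype.subsetP => i.
by rewrite !inE; apply: face_subset fG _.
Qed.

Lemma finite_faces F (E : set (set V)) : is_face P F ->
  E `<=` [set G | is_face F G] -> finite_set E.
Proof.
move=> fF EF; apply: (@sub_finite_set _ _ (conv a @` [set: {set U}])).
  move=> G /EF fG; exists (face_verts G) => //.
  by rewrite -face_polytope //; apply: face_of_face fF fG.
exact/finite_image/finite_finset.
Qed.

(** Every simplex contained in a face is carried by one of its faces. *)
Lemma carried_ex F A : is_face P F -> conv w A `<=` F ->
  exists2 G, is_face F G & carried w G A.
Proof.
have [n] := ubnP #|face_verts F|; elim: n F => // n IH F cF fF AF.
have [cA|] := pselect (carried w F A); first by exists F => //; apply: face_refl.
move=> ncA.
have [G [fG AG GF]] : exists G, [/\ is_face F G, conv w A `<=` G & G <> F].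
  apply: contrapT => nG; apply: ncA; split=> // G fG AG.
  by apply: contrapT => GF; apply: nG; exists G.
have fG' := face_of_face fF fG.
have [|H fH cH] := IH G _ fG' AG.
  by apply: leq_trans (face_verts_lt fF fG GF) _.
exists H => //; rewrite (face_polytope fF) in fG *.
exact: face_trans fG fH.
Qed.

Lemma carried_uniq F G G' A : is_face F G -> is_face F G' ->
  carried w G A -> carried w G' A -> G = G'.
Proof.
move=> fG fG' [AG GA] [AG' GA'].
have h1 : G `&` G' = G.
  apply: GA; first exact: face_restrict fG' (face_subset fG).
  by move=> x Ax; split; [apply: AG|apply: AG'].
have h2 : G' `&` G = G'.
  apply: GA'; first exact: face_restrict fG (face_subset fG').
  by move=> x Ax; split; [apply: AG'|apply: AG].
by rewrite -h1 setIC h2.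
Qed.

(** For [n >= 2], the number of interior lattice points of the dilation by
    [n - 1] of a standard simplex of dimension [#|A| - 1]; meant for nonempty
    [A]. *)
Definition weight (n : nat) (A : {set T}) : int := ('C(n - 2, #|A|.-1))%:Z.

(** The total weight of the simplices carried by [F]. *)
Definition inner_count F n : int :=
  \sum_(A in K | (A != finset.set0) && `[< carried w F A >]) weight n A.

(** Summing inner counts over a set of faces of [F] counts the simplices carried
    by one of these faces, since no simplex is carried by two faces. *)
Lemma sum_inner_count F (E : set (set V)) (Q : pred {set T}) n :
  is_face P F -> E `<=` [set G | is_face F G] ->
  (forall A, A \in K -> A != finset.set0 ->
     Q A <-> exists2 G, E G & carried w G A) ->
  \sum_(G \in E) inner_count G n =
  \sum_(A in K | (A != finset.set0) && Q A) weight n A.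
Proof.
move=> fF EF QE; have finE := finite_faces fF EF.
rewrite fsbig_finite //= /inner_count.
under eq_bigr do rewrite big_mkcond /=.
rewrite exchange_big [RHS]big_mkcond /=; apply: eq_bigr => A _.
case: (boolP (A \in K)) => [AK|_] /=; last by rewrite big1.
case: (boolP (A != finset.set0)) => [A0|_] /=; last by rewrite big1.
case: (boolP (Q A)) => QA.
  have [G EG cG] := (QE A AK A0).1 QA.
  have GE : G \in fset_set E by rewrite in_fset_set // inE.
  rewrite (bigD1_seq G) ?fset_uniq //= asboolT //.
  rewrite big1_seq ?addr0 // => H /andP[HG HE]; case: asboolP => // cH.
  rewrite in_fset_set // inE in HE.
  by case/eqP: HG; apply: carried_uniq (EF _ HE) (EF _ EG) cH cG.
rewrite big1_seq // => G /andP[_]; rewrite in_fset_set // inE => EG.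
case: asboolP => // cG; case/negP: QA; apply/(QE A AK A0).
by exists G.
Qed.

End FaceSums.

(** * Apexes of a pointed triangulation *)

Section Pointed.
Variables (R : realType) (m : nat).
Local Notation V := 'rV[R]_m.
Variables (U : finType) (a : U -> V) (P : set V).
Hypothesis PE : P = conv a [set: U]%SET.
Variables (T : finType) (w : T -> V) (K : {set {set T}}).
Hypothesis trP : triangulates w K P.
Variables (C : set (set V)) (apex : set V -> V).
Hypothesis CK : forall S, C S <-> exists2 A, A \in K & S = conv w A.
Hypothesis ptC : pointed_triangulation P C apex.
Implicit Types (A B S : {set T}) (F G : set V).

Let cK := tr_complex trP.

(** The induced triangulation of [F]. *)
Definition restriction F : {set {set T}} :=
  [set A in K | `[< conv w A `<=` F >]]%SET.

Lemma restrictionP F A : A \in restriction F <-> A \in K /\ conv w A `<=` F.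
Proof.
rewrite inE; split=> [/andP[AK /asboolP AF]|[AK AF]]; first by [].
by rewrite AK; apply/asboolP.
Qed.

Lemma triangulates_face F : is_face P F -> triangulates w (restriction F) F.
Proof.
move=> fF; split; first split.
- by move=> A /restrictionP[AK _]; apply: gc_indep cK _ AK.
- move=> A B /restrictionP[AK AF] BA; apply/restrictionP; split.
    exact: gc_down cK _ _ AK BA.
  by move=> x /(conv_sub BA)/AF.
- by move=> A B /restrictionP[AK _] /restrictionP[BK _]; apply: (gc_meet cK).
move=> x; split=> [Fx|[A /restrictionP[AK AF] Ax]]; last exact: AF.
have [A AK Ax] := (tr_cover trP x).1 (face_subset fF Fx).
have [S [l [SK SA lS xE]]] := inner_coords cK AK Ax.
have SP := triangulates_sub trP SK.
exists S; last by rewrite xE; apply: inner_conv.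
apply/restrictionP; split=> //; apply: (face_conv_sub fF SP) => i.
by apply: (inner_face fF SP lS); rewrite -xE.
Qed.

Lemma face_seg F : is_face P F ->
  forall x y (t : R), 0 <= t <= 1 -> F x -> F y -> F (x + t *: (y - x)).
Proof. by move=> /(face_polytope PE) -> x y t; apply: conv_seg. Qed.

Lemma face_prolong F x q : is_face P F -> F x -> F q ->
  (exists2 e : R, 0 < e & F (x - e *: (q - x))) \/
  exists G, [/\ is_face F G, G x & ~ G q].
Proof. by move=> /(face_polytope PE) ->; apply: prolong_or_face. Qed.

Lemma apex_in F : ne_face P F -> F (apex F).
Proof. by move=> neF; apply: (face_subset (pt_vert ptC neF)). Qed.

(** The apex of a face is a vertex of the triangulation. *)
Lemma apex_vertex F : ne_face P F -> exists t, [set t]%SET \in K /\ w t = apex F.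
Proof.
move=> neF; have [fF _] := neF; have fv := pt_vert ptC neF.
have [A /restrictionP[AK AF] Av] :=
  (tr_cover (triangulates_face fF) _).1 (apex_in neF).
have [S [l [SK SA lS vE]]] := inner_coords cK AK Av.
have [t tS] := conv_neq0 (inner_conv w lS).
exists t; split; first by apply: gc_down cK _ _ SK _; rewrite finset.sub1set.
have SF : conv w S `<=` F by move=> x /(conv_sub SA)/AF.
by apply: (inner_face fv SF lS) tS; rewrite /= -vE.
Qed.

(** The induced triangulation of a face is pure. *)
Lemma top_ex F k A : is_face P F -> has_dim F k -> A \in restriction F ->
  exists S, top (restriction F) k S /\ A \subset S.
Proof.
move=> fF dF AF; have trF := triangulates_face fF.
have [q gq] := generic_ex trF (face_seg fF) dF.
have [lq lqP] := generic_coords trF dF gq.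
have [->|A0] := eqVneq A finset.set0.
  have [S [tS _]] := half_open0 trF dF gq lqP.
  by exists S; split=> //; apply: finset.sub0set.
have [S [tS AS _]] := half_open trF (face_seg fF) dF gq lqP AF A0.
by exists S.
Qed.

Lemma apex_top F k S t : ne_face P F -> has_dim F k ->
  top (restriction F) k S -> [set t]%SET \in K -> w t = apex F -> t \in S.
Proof.
move=> neF dF tS tK tF; have [fF _] := neF.
have := tS => /andP[/restrictionP[SK SF] _].
apply: (vertex_mem cK tK SK); rewrite tF.
apply: (pt_full ptC fF dF (S := conv w S)); last first.
  exact (top_dim (triangulates_face fF) tS).
by split=> //; apply/CK; exists S.
Qed.

(** Adding the apex to a simplex of a face gives a simplex of that face. *)
Lemma cone_closed F A t : ne_face P F -> [set t]%SET \in K -> w t = apex F ->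
  A \in restriction F -> (t |: A)%SET \in restriction F.
Proof.
move=> neF tK tF AF; have [fF F0] := neF.
have [k dF] : exists k, has_dim F k.
  by move: F0; rewrite (face_polytope PE fF); apply: has_dim_ex.
have [S [tS AS]] := top_ex fF dF AF.
apply: (gc_down (tr_complex (triangulates_face fF)) (A := S)).
  by case/andP: tS.
by rewrite finset.subUset finset.sub1set (apex_top neF dF tS) // AS.
Qed.

(** A simplex that lies in no proper face of [F] contains the apex of [F]: a
    segment issuing from the apex can be prolonged beyond an inner point of the
    simplex, and the maximal simplex reached there contains the apex. *)
Lemma apex_carried F A t : ne_face P F -> A \in K -> A != finset.set0 ->
  carried w F A -> [set t]%SET \in K -> w t = apex F -> t \in A.
Proof.
move=> neF AK /(@inner_ex R)[l lA] [AF Aface] tK tF.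
have [fF F0] := neF; have trF := triangulates_face fF.
have [k dF] : exists k, has_dim F k.
  by move: F0; rewrite (face_polytope PE fF); apply: has_dim_ex.
have Al := inner_conv w lA.
have [[e e0]|[G [fG Gx Gq]]] := face_prolong fF (AF _ Al) (apex_in neF); last first.
  case: Gq; rewrite (Aface G fG); first exact: apex_in.
  by apply: (face_conv_sub fG AF) => i; apply: (inner_face fG AF lA).
set y := lin w l - _ => /(tr_cover trF)[B BF By].
have [S [tS BS]] := top_ex fF dF BF.
have := tS => /andP[/restrictionP[SK _] _].
have [ly [lyS ly0 yE]] := conv_sub BS By.
have tS' := apex_top neF dF tS tK tF.
(* [lin w l] divides the segment from [y] to the apex in the ratio [th]. *)
pose th := e / (1 + e).
have e1 : 0 < 1 + e by rewrite ltr_wpDl.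
have th0 : 0 < th by rewrite divr_gt0.
have th1 : th <= 1 by rewrite ler_pdivrMr // mul1r lerDr.
pose lx i := ly i + th * ((i == t)%:R - ly i).
have lxE : lin w lx = lin w l.
  rewrite lin_line lin_delta -yE tF /y.
  set q := apex F; set x := lin w l.
  have -> : q - (x - e *: (q - x)) = (1 + e) *: (q - x).
    by rewrite opprB addrCA scalerDl scale1r addrC.
  by rewrite scalerA divfK ?gt_eqF // subrK.
have lx0 i : 0 <= lx i.
  have -> : lx i = (1 - th) * ly i + th * (i == t)%:R by rewrite /lx; ring.
  by rewrite addr_ge0 // mulr_ge0 ?subr_ge0 // ltW.
have lxS : wts S lx by apply: wts_line => //; apply: wts_delta.
have := coords_uniq cK SK AK lxS lx0 (proj1 lA) (inner_nneg lA) lxE t.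
move=> lxt; apply: contraLR th0 => tA.
have : lx t = 0 by rewrite lxt (proj1 (proj1 lA)).
rewrite /lx eqxx /= mulr1n -leNgt => lxt0.
have : (1 - th) * ly t + th = 0 by rewrite -[RHS]lxt0; ring.
have : 0 <= (1 - th) * ly t by rewrite mulr_ge0 ?subr_ge0.
lra.
Qed.

End Pointed.

(** * The recursion for interior polytope numbers *)

Section Recursion.
Variables (R : realType) (m : nat).
Local Notation V := 'rV[R]_m.
Variables (U : finType) (a : U -> V) (P : set V).
Hypothesis PE : P = conv a [set: U]%SET.
Variables (T : finType) (w : T -> V) (K : {set {set T}}).
Hypothesis trP : triangulates w K P.
Variables (C : set (set V)) (apex : set V -> V).
Hypothesis CK : forall S, C S <-> exists2 A, A \in K & S = conv w A.
Hypothesis ptC : pointed_triangulation P C apex.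
Implicit Types (A B S : {set T}) (F G : set V).

Let cK := tr_complex trP.

Lemma conv_nonempty A : A != finset.set0 -> exists x, conv w A x.
Proof. by move=> /finset.set0Pn[i iA]; exists (w i); apply: conv_vertex. Qed.

(** The simplices of [F] that avoid the apex of [F] are those carried by the
    faces of [F] that avoid it. *)
Lemma carried_off_apex F t A : ne_face P F -> [set t]%SET \in K ->
  w t = apex F -> A \in K -> A != finset.set0 ->
  (`[< conv w A `<=` F >] && (t \notin A)) <->
  exists2 G, ne_face F G /\ ~ G (apex F) & carried w G A.
Proof.
move=> neF tK tF AK A0; have [fF _] := neF.
split=> [/andP[/asboolP AF tA]|[G [[fG _] vG] [AG _]]]; last first.
  apply/andP; split; first by apply/asboolP => x /AG/(face_subset fG).
  by apply: contra_notN vG => tA; rewrite -tF; apply: AG; exact: conv_vertex.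
have [G fG cG] := carried_ex PE fF AF.
have [x Ax] := conv_nonempty A0.
have neG : ne_face P G.
  by split; [exact: face_of_face PE _ _ fF fG|exists x; apply: (proj1 cG)].
exists G => //; split; first by split=> //; case: neG.
move=> vG; case/negP: tA.
suff vE : apex G = apex F.
  by apply: (apex_carried PE trP CK ptC neG AK A0 cG tK); rewrite vE.
apply: (pt_compat ptC neG neF) => y.
have GF := face_subset fG.
have [vGG vFF] := (apex_in ptC neG, apex_in ptC neF).
by case=> ->; split=> //; apply: GF.
Qed.

(** The simplices of [F] without the vertex [t], the empty simplex included. *)
Definition avoiding F t :=
  [pred A | (A \in K) && (`[< conv w A `<=` F >] && (t \notin A))].

Lemma sum_avoiding F t n :
  \sum_(A in K | (A != finset.set0) && (`[< conv w A `<=` F >] && (t \notin A)))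
    weight n A =
  \sum_(A | avoiding F t A) (if A == finset.set0 then 0 else weight n A).
Proof.
rewrite [RHS]big_mkcond [LHS]big_mkcond /=; apply: eq_bigr => A _.
by case: (A \in K) => //=; case: eqP => //= _; case: ifP.
Qed.

(** The simplices of a face form a cone over those avoiding its apex: [B] yields
    the two simplices [B] and [t |: B], whose weights add up by Pascal's rule. *)
Lemma sum_cone F t n : ne_face P F -> [set t]%SET \in K -> w t = apex F ->
  (2 <= n)%N ->
  \sum_(A in K | (A != finset.set0) && `[< conv w A `<=` F >]) weight n A =
  \sum_(A | avoiding F t A) ('C(n.-1, #|A|))%:Z.
Proof.
move=> neF tK tF n2; have [fF _] := neF.
rewrite (bigID (fun A : {set T} => t \in A)) /=.
have -> : \sum_(A | (A \in K) &&
      ((A != finset.set0) && `[< conv w A `<=` F >]) && (t \in A))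
    weight n A = \sum_(A | avoiding F t A) ('C(n - 2, #|A|))%:Z.
  rewrite (reindex_onto (fun B : {set T} => t |: B)%SET (fun A => A :\ t)%SET) /=;
    last by move=> A /andP[_ tA]; rewrite finset.setD1K.
  apply: eq_big => [B|B].
    rewrite finset.setU11 andbT.
    have [tB|tB] := boolP (t \in B).
      rewrite /= !andbF; apply/negP => /andP[_ /eqP tBE].
      by move: tB; rewrite -tBE !inE eqxx.
    rewrite finset.setU1K // eqxx !andbT.
    have -> : (t |: B != finset.set0)%SET.
      by apply/finset.set0Pn; exists t; rewrite !inE eqxx.
    apply/idP/idP => /= [/andP[BK /asboolP BF]|/andP[BK /asboolP BF]].
      have BtB : B \subset (t |: B)%SET by apply: finset.subsetUr.
      rewrite (gc_down cK BK) //=.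
      by apply/asboolP => x /(conv_sub BtB)/BF.
    have /restrictionP[tBK tBF] : (t |: B)%SET \in restriction w K F.
      by apply: (cone_closed PE trP CK ptC neF tK tF); apply/restrictionP.
    by rewrite tBK; apply/asboolP.
  move=> /andP[_ /eqP tBE]; rewrite /weight cardsU1.
  have -> : t \notin B by rewrite -tBE !inE eqxx.
  by [].
under [X in _ + X = _]eq_bigl do rewrite -andbA -andbA.
rewrite sum_avoiding -big_split; apply: eq_bigr => A _ /=.
rewrite /weight; have [->|A0] := eqVneq; first by rewrite cards0 !bin0.
move: A0; rewrite -card_gt0; case: #|A| => // c _.
by rewrite -PoszD /= -binS; congr (Posz 'C(_, _)); lia.
Qed.

Lemma empty_simplex : P !=set0 -> finset.set0 \in K.
Proof.
move=> [x /(tr_cover trP)[A AK _]]; apply: gc_down cK _ _ AK _.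
exact: finset.sub0set.
Qed.

Lemma conv_empty F : conv w finset.set0 `<=` F.
Proof. by move=> x /conv_neq0[i]; rewrite inE. Qed.

Variables (num inum : set V -> nat -> int).
Hypothesis pn : polytope_numbers P apex num inum.

(** The interior polytope number of a face is the total weight of the simplices
    that it carries. *)
Lemma inum_inner_count F n : ne_face P F -> (2 <= n)%N ->
  inum F n = inner_count w K F n.
Proof.
have [N] := ubnP #|face_verts a F|; elim: N F n => // N IH F n cF neF n2.
have [fF F0] := neF; have trF := triangulates_face trP fF.
have IHF G j : ne_face F G -> G <> F -> (2 <= j)%N ->
    inum G j = inner_count w K G j.
  move=> [fG G0] GF j2; apply: IH => //.
    by apply: leq_trans (face_verts_lt PE fF fG GF) _.
  by split=> //; apply: face_of_face PE _ _ fF fG.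
have [t [tK tF]] := apex_vertex trP ptC neF.
have t0 : [set t]%SET != finset.set0.
  by apply/finset.set0Pn; exists t; rewrite inE.
have tFF : [set t]%SET \in restriction w K F.
  apply/restrictionP; split=> //; rewrite conv1 => x ->; rewrite tF.
  exact: apex_in ptC _ neF.
have [k dF] : exists k, has_dim F k.
  by move: F0; rewrite (face_polytope PE fF); apply: has_dim_ex.
have [k0|kp] := posnP k.
  rewrite k0 in dF.
  have [_ ->] := pn_point pn neF dF (ltnW n2).
  rewrite /inner_count (big_pred1 [set t]%SET) /= => [|A].
    by rewrite /weight cards1 bin0.
  apply/idP/eqP => [/andP[AK /andP[A0 /asboolP cA]]|->].
    have tA := apex_carried PE trP CK ptC neF AK A0 cA tK tF.
    have AF : A \in restriction w K F by apply/restrictionP; case: cA.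
    apply/eqP; rewrite eq_sym eqEcard finset.sub1set tA cards1 /=.
    exact: card_simplex trF dF _ AF.
  rewrite tK t0 /=; apply/asboolP; split=> [|G fG tG].
    by have /restrictionP[] := tFF.
  have tt : top (restriction w K F) 0 [set t]%SET by rewrite /top tFF cards1.
  exact: top_face trF dF _ _ tt fG tG.
(* The weights of all nonempty simplices of [F] sum up to the right-hand side
   by [sum_cone], in a form that gives the correct value 1 also for [j = 1]. *)
have numE j : (1 <= j)%N ->
    num F j = \sum_(A | avoiding F t A) ('C(j.-1, #|A|))%:Z.
  elim: j => // -[_ _|j IHj _].
    have [-> _] := pn_at1 pn neF dF kp.
    have P0 : P !=set0 by have [x Fx] := F0; exists x; apply: face_subset fF _ Fx.
    rewrite (bigD1 finset.set0) /=; last first.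
      by rewrite (empty_simplex P0) inE asboolT //; apply: conv_empty.
    rewrite cards0 bin0 big1 ?addr0 // => A /andP[_].
    by rewrite -card_gt0; case: #|A|.
  rewrite (pn_num pn neF dF kp) // IHj //=.
  have -> : \sum_(G \in [set G | ne_face F G /\ ~ G (apex F)]) inum G j.+2 =
      \sum_(G \in [set G | ne_face F G /\ ~ G (apex F)]) inner_count w K G j.+2.
    apply: eq_fsbigr => G; rewrite inE => -[neG vG]; apply: IHF => // GF.
    by apply: vG; rewrite GF; apply: apex_in ptC _ neF.
  rewrite (sum_inner_count PE (F := F)
    (Q := [pred A | `[< conv w A `<=` F >] && (t \notin A)])) //=.
  - rewrite sum_avoiding -big_split; apply: eq_bigr => A _ /=.
    rewrite /weight subn2 /=; have [->|A0] := eqVneq; first by rewrite cards0 !bin0.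
    by move: A0; rewrite -card_gt0; case: #|A|.
  - by move=> G [[]].
  - by move=> A AK A0; apply: carried_off_apex.
rewrite (pn_inum pn neF dF kp) // numE ?(ltnW n2) //.
have -> : \sum_(G \in [set G | ne_face F G /\ G <> F]) inum G n =
    \sum_(G \in [set G | ne_face F G /\ G <> F]) inner_count w K G n.
  by apply: eq_fsbigr => G; rewrite inE => -[neG GF]; apply: IHF.
rewrite (sum_inner_count PE (F := F)
  (Q := [pred A | `[< conv w A `<=` F >] && ~~ `[< carried w F A >]])) //=.
- rewrite -(sum_cone neF tK tF n2) (bigID (fun A => `[< carried w F A >])) /=.
  under [X in _ + X - _]eq_bigl do rewrite -andbA -andbA.
  rewrite addrK; apply: eq_bigl => A; rewrite -andbA -andbA; do 2!congr (_ && _).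
  by apply: andb_idl => /asboolP[AF _]; apply/asboolP.
- by move=> G [[]].
move=> A AK A0; split=> [/andP[/asboolP AF /asboolP ncF]|[G [[fG _] GF] cG]].
  have [G fG cG] := carried_ex PE fF AF.
  exists G => //; split; last by move=> GF; apply: ncF; rewrite -GF.
  split=> //; have [x Ax] := conv_nonempty A0.
  by exists x; apply: (proj1 cG).
apply/andP; split; first by apply/asboolP => x /(proj1 cG)/(face_subset fG).
apply/asboolP => cF'; apply: GF.
exact: carried_uniq fG (face_refl F) cG cF'.
Qed.

End Recursion.

(** * The h-vector and the interior count *)

Section HVector.
Variables (R : realType) (m : nat).
Local Notation V := 'rV[R]_m.
Variables (U : finType) (a : U -> V) (P : set V) (d : nat).
Hypothesis PE : P = conv a [set: U]%SET.
Variables (T : finType) (w : T -> V) (K : {set {set T}}).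
Hypothesis trP : triangulates w K P.
Variable (C : set (set V)).
Hypothesis CK : forall S, C S <-> exists2 A, A \in K & S = conv w A.
Hypothesis dimP : has_dim P d.
Implicit Types (A B S : {set T}) (F G : set V).

Let cK := tr_complex trP.

Lemma fvec_card j : fvec C j = #|[set A in K | #|A| == j]%SET|.
Proof.
case: j => [|j] /=.
  rewrite -(cards1 (finset.set0 : {set T})); congr #|pred_of_set _|.
  apply/setP => A; rewrite !inE cards_eq0 andb_idl // => /eqP ->.
  exact: empty_simplex trP (has_dim_neq0 dimP).
set X := [set A in K | #|A| == j.+1]%SET.
have XP (S : set V) : C S /\ has_dim S j <-> exists2 A, A \in X & S = conv w A.
  split=> [[/CK[A AK ->] dA]|[A]].
    exists A => //=; rewrite inE AK /=.
    have A0 : A != finset.set0.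
      apply/eqP => A0; have [x] := has_dim_neq0 dA.
      by rewrite A0 => /conv_neq0[i]; rewrite inE.
    have := has_dim_uniq dA (has_dim_face_simplex trP AK A0).
    by move: A0; rewrite -card_gt0; lia.
  rewrite inE => /andP[AK /eqP Aj] ->.
  split; first by apply/CK; exists A.
  have := has_dim_face_simplex trP AK; rewrite Aj; apply.
  by rewrite -cards_eq0 Aj.
have finX : finite_set [set S : set V | C S /\ has_dim S j].
  apply: (@sub_finite_set _ _ (conv w @` [set: {set T}])).
    by move=> S /XP[A _ ->]; exists A.
  exact/finite_image/finite_finset.
rewrite cardE -(size_map (conv w)); apply/perm_size/uniq_perm.
- exact: fset_uniq.
- rewrite map_inj_in_uniq ?enum_uniq // => A B.
  rewrite !mem_enum !inE => /andP[AK _] /andP[BK _].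
  exact: conv_inj cK _ _ AK BK.
move=> S; rewrite in_fset_set //; apply/idP/mapP.
  by rewrite inE => /XP[A AX ->]; exists A; rewrite ?mem_enum.
by move=> [A]; rewrite mem_enum => AX ->; rewrite inE; apply/XP; exists A.
Qed.

Variables (q : V) (lq : {set T} -> T -> R).
Hypothesis gq : generic w K P d q.
Hypothesis lqP : forall S, top K d S -> [/\ wts S (lq S), q = lin w (lq S) &
  forall i, i \in S -> lq S i != 0].

(** The vertices of [S] at which the generic point has a negative, respectively
    positive, barycentric coordinate. *)
Definition neg S := [set i in S | lq S i < 0]%SET.
Definition pos S := [set i in S | 0 < lq S i]%SET.

Lemma card_neg_pos S : top K d S -> (#|neg S| + #|pos S| = d.+1)%N.
Proof.
move=> tS; have [_ _ l0] := lqP tS; have /andP[_ /eqP <-] := tS.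
rewrite -cardsUI.
have -> : (neg S :|: pos S = S)%SET.
  apply/setP => i; rewrite !inE -andb_orr -neq_lt.
  by case: (boolP (i \in S)) => //= /l0.
have -> : (neg S :&: pos S = finset.set0)%SET; last by rewrite cards0 addn0.
apply/setP => i; rewrite !inE; apply/negP => /andP[/andP[_ i1] /andP[_ i2]].
by have := lt_trans i1 i2; rewrite ltxx.
Qed.

Lemma pos_neq0 S : top K d S -> pos S != finset.set0.
Proof.
move=> tS; have [[lS l1] _ _] := lqP tS.
apply: contra_eqN l1 => /eqP p0; rewrite lt_eqF //.
apply: le_lt_trans ltr01; apply: sumr_le0 => i _.
have [iS|/lS ->//] := boolP (i \in S); rewrite leNgt; apply/negP => li.
by have : i \in pos S; [rewrite inE iS|rewrite p0 inE].
Qed.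

Lemma neg_sub S A : top K d S -> (neg S \subset A) <->
  (forall i, i \in S -> i \notin A -> 0 < lq S i).
Proof.
move=> tS; have [_ _ l0] := lqP tS; split=> [/fintype.subsetP sub i iS iA|sub].
  rewrite lt_def l0 //= leNgt; apply: contra iA => li.
  by apply: sub; rewrite inE iS.
apply/fintype.subsetP => i; rewrite inE => /andP[iS li].
by apply: contraT => /(sub i iS)/(lt_trans li); rewrite ltxx.
Qed.

Lemma pos_sub S A : top K d S -> (pos S \subset A) <->
  (forall i, i \in S -> i \notin A -> lq S i < 0).
Proof.
move=> tS; have [_ _ l0] := lqP tS; split=> [/fintype.subsetP sub i iS iA|sub].
  rewrite lt_neqAle l0 //= leNgt; apply: contra iA => li.
  by apply: sub; rewrite inE iS.
apply/fintype.subsetP => i; rewrite inE => /andP[iS li].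
by apply: contraT => /(sub i iS)/(lt_trans li); rewrite ltxx.
Qed.

Let segP : forall x y (t : R), 0 <= t <= 1 -> P x -> P y -> P (x + t *: (y - x)).
Proof. by rewrite PE => x y t; apply: conv_seg. Qed.

Let prolongP x : P x -> (exists2 e : R, 0 < e & P (x - e *: (q - x))) \/
  exists G, [/\ is_face P G, G x & ~ G q].
Proof.
by have [Pq _] := gq; move: Pq; rewrite PE => Pq Px; apply: prolong_or_face.
Qed.

Lemma top_in S A : top K d S -> A \subset S -> A \in K.
Proof. by move=> /andP[SK _]; apply: gc_down cK _ _ SK. Qed.

(** [h_j] counts the d-simplices on which the generic point has [j] negative
    coordinates: the intervals [[neg S, S]] partition the complex. *)
Lemma hvecE j : (j <= d.+1)%N ->
  hvec C d j = \sum_(S | top K d S) (#|neg S| == j)%:R.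
Proof.
move=> jd.
pose g i : int := if (i <= j)%N then
  (-1) ^+ (j - i) * ('C(d.+1 - i, d.+1 - j))%:Z else 0.
transitivity (\sum_(A in K) g #|A|).
  rewrite /hvec (bigID (fun A : {set T} => (#|A| <= j)%N)) /=.
  rewrite [X in _ = _ + X]big1 ?addr0; last first.
    by move=> A /andP[_ /negPf Aj]; rewrite /g Aj.
  rewrite (partition_big (fun A : {set T} => inord #|A| : 'I_j.+1) predT) //=.
  apply: eq_bigr => i _.
  rewrite fvec_card -sum1_card -[X in _ * X = _]natz natr_sum mulr_sumr.
  apply: eq_big => [A|A].
    rewrite inE -andbA; apply: andb_id2l => _.
    apply/eqP/andP => [Ai|[Aj /eqP <-]]; last by rewrite inordK.
    rewrite Ai -ltnS ltn_ord; split=> //; apply/eqP/val_inj => /=.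
    by rewrite inordK.
  rewrite inE => /andP[_ /eqP ->]; rewrite mulr1 /g.
  by rewrite -ltnS ltn_ord.
rewrite (sum_partition (N := neg) (tops := top K d)).
- apply: eq_bigr => S tS; have cS := card_neg_pos tS.
  rewrite sum_interval; last by apply/fintype.subsetP => i; rewrite inE => /andP[].
  have /andP[_ /eqP ->] := tS.
  by rewrite hvec_interval //; lia.
- move=> A AK; have [->|A0] := eqVneq A finset.set0.
    have [S [tS sS]] := half_open0 trP dimP gq lqP.
    exists S; split=> //; last exact: finset.sub0set.
    by apply/(neg_sub _ tS) => i iS _; apply: sS.
  have [S [tS AS sS]] := half_open trP segP dimP gq lqP AK A0.
  by exists S; split=> //; apply/(neg_sub _ tS).
- move=> A S S' AK tS /(neg_sub _ tS) nS AS tS' /(neg_sub _ tS') nS' AS'.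
  have [A0|A0] := eqVneq A finset.set0.
    apply: (half_open0_uniq trP lqP tS _ tS') => i iS.
      by apply: nS => //; rewrite A0 inE.
    by apply: nS' => //; rewrite A0 inE.
  exact (half_open_uniq trP lqP A0 tS AS nS tS' AS' nS').
by move=> A S tS _; apply: top_in.
Qed.

Lemma carried_pos S : top K d S -> carried w P (pos S).
Proof.
move=> tS; have pS : pos S \subset S.
  by apply/fintype.subsetP => i; rewrite inE => /andP[].
have pK := top_in tS pS.
apply/(half_open_interior trP segP dimP gq lqP (pos_neq0 tS) pK prolongP).
by exists S; split=> //; apply/(pos_sub _ tS).
Qed.

(** The intervals [[pos S, S]] partition the simplices carried by [P]. *)
Lemma inner_countE n : (2 <= n)%N -> inner_count w K P n =
  \sum_(S | top K d S) ('C(#|neg S| + (n - 2), d))%:Z.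
Proof.
move=> n2; rewrite /inner_count.
rewrite [LHS](sum_partition (N := pos) (tops := top K d)).
- apply: eq_bigr => S tS; have cS := card_neg_pos tS.
  rewrite (sum_interval (fun c => ('C(n - 2, c.-1))%:Z)); last first.
    by apply/fintype.subsetP => i; rewrite inE => /andP[].
  have /andP[_ /eqP ->] := tS.
  have -> : (d.+1 - #|pos S| = #|neg S|)%N by lia.
  have p0 : (0 < #|pos S|)%N by rewrite card_gt0 pos_neq0.
  rewrite -(vandermonde_interval _ p0 cS) -[RHS]natz natr_sum.
  by apply: eq_bigr => t _; rewrite natz PoszM.
- move=> A /andP[AK /andP[A0 /asboolP cA]].
  have [S [tS AS sS]] :=
    (half_open_interior trP segP dimP gq lqP A0 AK prolongP).1 cA.
  by exists S; split=> //; apply/(pos_sub _ tS).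
- move=> A S S' /andP[AK /andP[A0 cA]] tS /(pos_sub _ tS) nS AS.
  move=> tS' /(pos_sub _ tS') nS' AS'.
  have [l lA] := @inner_ex R _ _ A0.
  have sgn S1 : (forall i, i \in S1 -> i \notin A -> lq S1 i < 0) ->
      forall i, i \in S1 -> i \notin A -> 0 < -1 * lq S1 i.
    by move=> sS1 i iS iA; rewrite mulN1r oppr_gt0 sS1.
  exact (step_uniq trP lqP lA tS AS (sgn _ nS) tS' AS' (sgn _ nS')).
move=> A S tS pA AS; have AK := top_in tS AS.
have A0 : A != finset.set0.
  by apply: contraNneq (pos_neq0 tS) => A0; rewrite -finset.subset0 -A0.
rewrite AK A0 /=; apply/asboolP.
apply/(half_open_interior trP segP dimP gq lqP A0 AK prolongP).
by exists S; split=> //; apply/(pos_sub _ tS).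
Qed.

(** Both sides vanish when the argument of the simplex number is not positive. *)
Lemma simplex_numberE n c : (2 <= n)%N -> (1 <= d)%N ->
  ('C(c + (n - 2), d))%:Z = simplex_number d (n%:Z - d%:Z - 1 + c%:Z).
Proof.
move=> n2 d1; rewrite /simplex_number; case: ifP => z1.
  by congr (Posz 'C(_, _)); lia.
by rewrite bin_small //; lia.
Qed.

End HVector.

(** * The interior polytope numbers in terms of the h-vector *)

Theorem theorem2 (R : realType) (m d : nat) (P : set 'rV[R]_m)
    (C : set (set 'rV[R]_m)) (apex : set 'rV[R]_m -> 'rV[R]_m)
    (num inum : set 'rV[R]_m -> nat -> int) :
  is_polytope P -> has_dim P d -> (1 <= d)%N ->
  pointed_triangulation P C apex ->
  polytope_numbers P apex num inum ->
  forall n : nat, (1 <= n)%N ->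
    inum P n =
      \sum_(j < d) hvec C d j * simplex_number d (n%:Z - d%:Z - 1 + j%:Z).
Proof.
move=> polyP dimP d1 ptC pn n n1.
have neP : ne_face P P by split; [exact: face_refl|exact: has_dim_neq0 dimP].
have [n2|] := leqP 2 n; last first.
  case: n n1 => [|[|]] // _ _; have [_ ->] := pn_at1 pn neP dimP d1.
  rewrite big1 // => j _; rewrite /simplex_number ifF ?mulr0 //.
  by apply/negbTE; have := ltn_ord j; lia.
have [U [a PE]] := polytope_family polyP.
have [T [w [K [trP CK]]]] := triangulation_complex (pt_triang ptC).
have segP (x y : 'rV[R]_m) (t : R) :
    0 <= t <= 1 -> P x -> P y -> P (x + t *: (y - x)).
  exact: face_seg PE _ (face_refl P) x y t.
have [q gq] := generic_ex trP segP dimP.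
have [lq lqP] := generic_coords trP dimP gq.
have cNP S : top K d S -> (#|neg lq S| + #|pos lq S| = d.+1)%N.
  exact: card_neg_pos lqP S.
(* A vertex carried by [P] would be the apex of [P], which is a proper face
   of [P]. *)
have neg_lt S : top K d S -> (#|neg lq S| < d)%N.
  move=> tS; have := cNP S tS.
  have p0 : (0 < #|pos lq S|)%N by rewrite card_gt0 (pos_neq0 lqP tS).
  have [/eqP/cards1P[i posE] _|] := eqVneq #|pos lq S| 1; last by lia.
  have cP := carried_pos PE trP dimP gq lqP tS.
  rewrite posE in cP.
  have iK : [set i]%SET \in K.
    rewrite -posE; apply: (top_in trP tS).
    by apply/fintype.subsetP => j; rewrite inE => /andP[].
  have i0 : [set i]%SET != finset.set0 by rewrite -cards_eq0 cards1.
  have [t [tK tE]] := apex_vertex trP ptC neP.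
  have := apex_carried PE trP CK ptC neP iK i0 cP tK tE.
  rewrite inE => /eqP ti; rewrite -ti in cP i0.
  have PE' : conv w [set t]%SET = P.
    by apply: (proj2 cP) => //; rewrite conv1 tE; apply: pt_vert ptC _ neP.
  have := has_dim_face_simplex trP tK i0.
  by rewrite PE' cards1 => /(has_dim_uniq dimP) d0; rewrite d0 in d1.
rewrite (inum_inner_count PE trP CK ptC pn neP n2).
rewrite (inner_countE PE trP dimP gq lqP n2).
transitivity (\sum_(j < d) \sum_(S | top K d S) (#|neg lq S| == j)%:R *
    simplex_number d (n%:Z - d%:Z - 1 + j%:Z)); last first.
  apply: eq_bigr => j _; rewrite (hvecE PE trP CK dimP gq lqP) ?mulr_suml //.
  by have := ltn_ord j; lia.
rewrite exchange_big /=; apply: eq_bigr => S tS.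
rewrite (bigD1 (Ordinal (neg_lt S tS))) //= eqxx mul1r big1 ?addr0.
  exact: simplex_numberE.
move=> j jS; rewrite (negbTE (_ : #|neg lq S| != j)) ?mul0r //.
by apply: contra jS => /eqP jE; apply/eqP/val_inj.
Qed.
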